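(* Let $\boldsymbol{k}=(k_1,\ldots,k_r)$ be any composition, let $k\in\mathbb{N}$, and put $n:=|\boldsymbol{k}|+1-\mathrm{dep}(\boldsymbol{k})$. Then for any $\alpha\in\mathbb{C}\setminus\mathbb{N}$, the following formulas hold: $$\int_0^1\frac{\mathrm{Li}_{\boldsymbol{k}}(x)\log^k(1-x)}{x(1-x)^\alpha}\,dx=(-1)^k k!\sum_{\substack{\boldsymbol{j}\in\mathbb{N}_0^n\\ |\boldsymbol{j}|=k}} B\big((\overleftarrow{\boldsymbol{k}}^\vee)_+;\boldsymbol{j}\big)\,\zeta\big((\overleftarrow{\boldsymbol{k}}^\vee)_++\boldsymbol{j};1-\alpha\big),$$ $$\int_0^1\frac{\mathrm{A}(\boldsymbol{k};x)\log^k\!\big(\frac{1-x}{1+x}\big)}{x\big(\frac{1-x}{1+x}\big)^\alpha}\,dx=(-1)^k k!\sum_{\substack{\boldsymbol{j}\in\mathbb{N}_0^n\\ |\boldsymbol{j}|=k}} B\big((\overleftarrow{\boldsymbol{k}}^\vee)_+;\boldsymbol{j}\big)\,T\big((\overleftarrow{\boldsymbol{k}}^\vee)_++\boldsymbol{j};1-\alpha\big).$$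
   Context: $\mathbb{N}$ is the set of positive integers, $\mathbb{N}_0=\mathbb{N}\cup\{0\}$. A composition is a finite sequence $\boldsymbol{k}=(k_1,\ldots,k_r)\in\mathbb{N}^r$, $r\ge 1$; its weight is $|\boldsymbol{k}|=k_1+\cdots+k_r$ and its depth is $\mathrm{dep}(\boldsymbol{k})=r$ (also $|\boldsymbol{j}|$ is the sum of the entries for $\boldsymbol{j}\in\mathbb{N}_0^n$). The reversal is $\overleftarrow{\boldsymbol{k}}=(k_r,\ldots,k_1)$, and $\boldsymbol{k}_+=(k_1+1,k_2,\ldots,k_r)$. The Hoffman dual $\boldsymbol{k}^\vee=(k'_1,\ldots,k'_{r'})$ of $\boldsymbol{k}$ is the unique composition of the same weight such that $\{1,2,\ldots,|\boldsymbol{k}|-1\}$ is the disjoint union of $\{\sum_{i=1}^{j}k_i: 1\le j\le r-1\}$ and $\{\sum_{i=1}^{j}k'_i:1\le j\le r'-1\}$. The notation $\overleftarrow{\boldsymbol{k}}^\vee$ means $(\overleftarrow{\boldsymbol{k}})^\vee$; it has depth $n=|\boldsymbol{k}|+1-\mathrm{dep}(\boldsymbol{k})$. For $\boldsymbol{k}\in\mathbb{N}^r$ and $\boldsymbol{j}\in\mathbb{N}_0^r$, $\boldsymbol{k}+\boldsymbol{j}$ is the componentwise sum and $B(\boldsymbol{k};\boldsymbol{j})=\prod_{i=1}^r\binom{k_i+j_i-1}{j_i}$. For $0\le x<1$, $$\mathrm{Li}_{\boldsymbol{k}}(x)=\sum_{n_1>\cdots>n_r>0}\frac{x^{n_1}}{n_1^{k_1}\cdots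 n_r^{k_r}},\qquad \mathrm{A}(\boldsymbol{k};x)=2^r\sum_{\substack{n_1>n_2>\cdots>n_r>0\\ n_j\equiv r+1-j\ (\mathrm{mod}\ 2)}}\frac{x^{n_1}}{n_1^{k_1}\cdots n_r^{k_r}}.$$ For a composition $\boldsymbol{k}=(k_1,\ldots,k_r)$ with $k_1>1$ and $\beta\in\mathbb{C}\setminus\{0,-1,-2,\ldots\}$, the Hurwitz-type multiple zeta values and multiple $T$-values are $$\zeta(\boldsymbol{k};\beta)=\sum_{n_1>\cdots>n_r>0}\frac{1}{(n_1+\beta-1)^{k_1}\cdots(n_r+\beta-1)^{k_r}},$$ $$T(\boldsymbol{k};\beta)=\sum_{m_1>\cdots>m_r>0}\ \prod_{i=1}^r\frac{2}{(2m_i-r-2+i+\beta)^{k_i}},$$ the sums being over positive integers. Complex powers of positive reals are $y^\alpha=\exp(\alpha\log y)$ with the real logarithm.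
   Formalization: The integrals converge only for Re α < 1, where the formulas are proved literally; for other α in ℂ∖ℕ the divergent integral is replaced by its unique analytic continuation in α. *)

(* Defs.v *)
From Stdlib Require Import Reals.
From Coquelicot Require Import Coquelicot.
From mathcomp Require Import ssreflect ssrfun ssrbool eqtype ssrnat seq path.
From mathcomp Require Import div choice fintype tuple bigop binomial.

Set Implicit Arguments.
Unset Strict Implicit.
Unset Printing Implicit Defensive.

Local Open Scope nat_scope.

Definition is_composition (k : seq nat) : bool := (k != [::]) && (0 \notin k).

Definition weight (k : seq nat) : nat := sumn k.
Definition dep (k : seq nat) : nat := size k.

Definition plus_head (k : seq nat) : seq nat :=
  if k is k1 :: k' then k1.+1 :: k' else [::].

(* The proper partial sums k_1 + ... + k_j, 1 <= j <= r - 1. *)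
Definition partial_sums (k : seq nat) : seq nat :=
  [seq sumn (take j k) | j <- iota 1 (dep k).-1].

(* The defining property of the Hoffman dual k' of k.  As the right-hand side
   is duplicate-free, the [perm_eq] says that {1, ..., |k| - 1} is the disjoint
   union of the two sets of partial sums. *)
Definition is_hoffman_dual (k k' : seq nat) : Prop :=
  [/\ is_composition k', weight k' = weight k
    & perm_eq (partial_sums k ++ partial_sums k') (iota 1 (weight k).-1)].

(* The Hoffman dual is computed by taking the consecutive differences of
   0 < s_1 < ... < s_p < |k|, where the s_i are the elements of
   {1, ..., |k| - 1} that are not partial sums of k. *)
Definition hoffman_dual (k : seq nat) : seq nat :=
  pairmap (fun a b => b - a) 0
    (rcons [seq i <- iota 1 (weight k).-1 | i \notin partial_sums k]
           (weight k)).

Lemma partial_sumsE k : k != [::] ->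
  rcons (partial_sums k) (weight k) = scanl addn 0 k.
Proof.
move=> k0; have sk : 0 < size k by rewrite lt0n size_eq0.
apply: (@eq_from_nth _ 0).
  by rewrite size_rcons size_map size_iota size_scanl prednK.
move=> i; rewrite size_rcons size_map size_iota prednK // => ik.
have foldE s : forall a, foldl addn a s = a + sumn s.
  elim: s => [|b s IH] a /=; first by rewrite addn0.
  by rewrite IH addnA.
rewrite nth_scanl // foldE add0n nth_rcons size_map size_iota.
case: ltnP => ip.
  by rewrite (nth_map 0) ?size_iota // nth_iota // add1n.
have -> : i = (size k).-1 by apply/eqP; rewrite eqn_leq ip -ltnS prednK // ik.
by rewrite eqxx prednK // take_size.
Qed.

Lemma pairmap_subnK a s : path ltn a s ->
  scanl addn a (pairmap (fun x y => y - x) a s) = s.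
Proof.
elim: s a => [//|b s IH] a /= /andP[ab ps].
by rewrite subnKC ?(ltnW ab) // IH.
Qed.

Lemma pairmap_scanlK a s :
  pairmap (fun x y => y - x) a (scanl addn a s) = s.
Proof. by elim: s a => [//|b s IH] a /=; rewrite addKn IH. Qed.

Lemma pairmap_subn_neq0 a s : path ltn a s ->
  0 \notin pairmap (fun x y => y - x) a s.
Proof.
elim: s a => [//|b s IH] a /= /andP[ab ps].
by rewrite inE negb_or IH // andbT eq_sym -lt0n subn_gt0.
Qed.

Lemma scanl_path a s : 0 \notin s -> path ltn a (scanl addn a s).
Proof.
elim: s a => [//|b s IH] a /=; rewrite inE negb_or => /andP[b0 s0].
by rewrite IH // andbT -{1}(addn0 a) ltn_add2l lt0n eq_sym.
Qed.

Lemma composition_partial_sums k : is_composition k ->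
  path ltn 0 (rcons (partial_sums k) (weight k)).
Proof. by case/andP=> k0 kp; rewrite partial_sumsE // scanl_path. Qed.

Lemma partial_sums_sorted k : is_composition k -> sorted ltn (partial_sums k).
Proof.
move/composition_partial_sums; rewrite -cats1 cat_path => /andP[/path_sorted //].
Qed.

Lemma mem_partial_sums k i : is_composition k -> i \in partial_sums k ->
  i \in iota 1 (weight k).-1.
Proof.
move=> ck ik.
have /= := composition_partial_sums ck.
rewrite rcons_path => /andP[p0 pl].
have i0 : 0 < i by move: p0; rewrite (path_sortedE ltn_trans) => /andP[/allP/(_ _ ik)].
have iw : i < weight k.
  have := composition_partial_sums ck => /path_sorted.
  rewrite -cats1 (sorted_pairwise ltn_trans) pairwise_cat => /andP[H _].
  by move/allrelP: H => /(_ i (weight k) ik); rewrite inE eqxx; apply.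
by rewrite mem_iota i0 add1n prednK // (leq_ltn_trans _ iw).
Qed.

Lemma partial_sums_inj k1 k2 : is_composition k1 -> is_composition k2 ->
  weight k1 = weight k2 -> partial_sums k1 = partial_sums k2 -> k1 = k2.
Proof.
move=> /andP[n1 _] /andP[n2 _] ew ep.
rewrite -[LHS](pairmap_scanlK 0) -[RHS](pairmap_scanlK 0).
by rewrite -!partial_sumsE // ew ep.
Qed.

Lemma hoffman_dualP k : is_composition k ->
  is_hoffman_dual k (hoffman_dual k).
Proof.
move=> ck; set s := [seq i <- iota 1 (weight k).-1 | i \notin partial_sums k].
have wk : 0 < weight k.
  by case/andP: ck; case: k {s} => [//|[|a] k'].
have ps : path ltn 0 (rcons s (weight k)).
  have : subseq (rcons s (weight k)) (iota 1 (weight k)).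
    have -> : iota 1 (weight k) = rcons (iota 1 (weight k).-1) (weight k).
      by case: (weight k) wk => // w _; rewrite -[in LHS](addn1 w) iotaD cats1 add1n.
    by rewrite -!cats1 cat_subseq ?filter_subseq.
  move=> sub; apply: (subseq_path ltn_trans sub).
  by apply: (iota_ltn_sorted 0 (weight k).+1).
have hn : hoffman_dual k != [::].
  by rewrite -size_eq0 size_pairmap size_rcons.
have E : rcons (partial_sums (hoffman_dual k)) (weight (hoffman_dual k))
         = rcons s (weight k).
  by rewrite partial_sumsE // pairmap_subnK.
have [Es Ew] := rcons_inj E.
split=> //.
  by rewrite /is_composition hn pairmap_subn_neq0.
rewrite Es; apply: uniq_perm; last 1 first.
- move=> i; rewrite mem_cat mem_filter.
  by case: (boolP (i \in partial_sums k)) => //= /mem_partial_sums ->.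
- rewrite cat_uniq filter_uniq ?iota_uniq // andbT.
  rewrite (sorted_uniq ltn_trans ltnn) ?partial_sums_sorted //=.
  by apply/hasPn=> i; rewrite mem_filter => /andP[].
- exact: iota_uniq.
Qed.

Lemma hoffman_dual_uniq k k1 k2 :
  is_hoffman_dual k k1 -> is_hoffman_dual k k2 -> k1 = k2.
Proof.
move=> [c1 w1 p1] [c2 w2 p2].
apply: partial_sums_inj => //; first by rewrite w1 w2.
apply: (irr_sorted_eq ltn_trans ltnn); rewrite ?partial_sums_sorted //.
by apply: perm_mem; rewrite -(perm_cat2l (partial_sums k)) (perm_trans p1) 1?perm_sym.
Qed.

Definition addc (k j : seq nat) : seq nat := [seq p.1 + p.2 | p <- zip k j].

Definition B_coef (k j : seq nat) : nat :=
  \prod_(p <- zip k j) 'C(p.1 + p.2 - 1, p.2).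

(* [dec_sum r f N] is the sum over N > n_1 > ... > n_r > 0 of
   f 1 n_1 * f 2 n_2 * ... * f r n_r, in the ring K (here R or C). *)
Fixpoint dec_sum (K : Ring) (r : nat) (f : nat -> nat -> K) (N : nat) : K :=
  if r is r'.+1 then
    sum_n_m (fun n => mult (f 1 n) (dec_sum r' (fun i => f i.+1) n)) 1 N.-1
  else one.

(* The multiple series over n_1 > ... > n_r > 0, as the limits of the partial
   sums over N > n_1.  All the series below converge absolutely under the
   hypotheses with which they are used, so that the order of summation is
   immaterial. *)
Definition RSum (r : nat) (f : nat -> nat -> R) : R :=
  real (Lim_seq (dec_sum r f)).

Definition CSum (r : nat) (f : nat -> nat -> C) : C :=
  (real (Lim_seq (fun N => Re (dec_sum r f N))),
   real (Lim_seq (fun N => Im (dec_sum r f N)))).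

Definition entry (k : seq nat) (i : nat) : nat := nth 0 k i.-1.

Definition Li (k : seq nat) (x : R) : R :=
  RSum (dep k) (fun i n =>
    ((if (i == 1)%N then x ^ n else 1) / INR n ^ entry k i)%R).

Definition A_fun (k : seq nat) (x : R) : R :=
  let r := dep k in
  (2 ^ r * RSum r (fun i n =>
    if (n == r + 1 - i %[mod 2])%N
    then (if (i == 1)%N then x ^ n else 1) / INR n ^ entry k i
    else 0))%R.

Definition zetaH (k : seq nat) (beta : C) : C :=
  CSum (dep k) (fun i n =>
    (/ (RtoC (INR n) + beta - RtoC 1) ^ entry k i)%C).

Definition TH (k : seq nat) (beta : C) : C :=
  let r := dep k in
  CSum r (fun i m =>
    (RtoC 2 / (RtoC 2 * RtoC (INR m) - RtoC (INR r) - RtoC 2 + RtoC (INR i)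
               + beta) ^ entry k i)%C).

Definition cexp (z : C) : C :=
  (exp (Re z) * cos (Im z), exp (Re z) * sin (Im z))%R.

Definition cpower (y : R) (alpha : C) : C := cexp (alpha * RtoC (ln y))%C.

Definition Li_integrand (k : seq nat) (m : nat) (alpha : C) (x : R) : C :=
  (RtoC (Li k x * ln (1 - x) ^ m) / (RtoC x * cpower (1 - x) alpha))%C.

Definition A_integrand (k : seq nat) (m : nat) (alpha : C) (x : R) : C :=
  (RtoC (A_fun k x * ln ((1 - x) / (1 + x)) ^ m)
   / (RtoC x * cpower ((1 - x) / (1 + x)) alpha))%C.

Definition positive_integer (alpha : C) : Prop :=
  exists p : nat, 0 < p /\ alpha = RtoC (INR p).

(* [integral01 g alpha v]: the value at alpha of the integral over ]0, 1[ of
   g alpha is v.  The integrals considered here converge exactly for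
   Re alpha < 1, where v is the value of the convergent improper integral; for
   the other alpha outside the positive integers the integral stands for its
   analytic continuation in alpha, which is unique because the complement of
   the positive integers is connected. *)
Definition integral01 (g : C -> R -> C) (alpha v : C) : Prop :=
  exists F : C -> C,
    [/\ forall a, (Re a < 1)%R ->
          is_RInt_gen (V := C_R_NormedModule) (g a)
            (at_right 0%R) (at_left 1%R) (F a),
        forall a, ~ positive_integer a ->
          ex_derive (K := C_AbsRing) (V := C_NormedModule) F a
      & F alpha = v].

(* (-1)^m m! times the sum over j in N_0^n with |j| = m of
   B(k; j) Z(k + j; beta).  The entries of such a j are at most m. *)
Definition weighted_sum (Z : seq nat -> C -> C) (k : seq nat) (n m : nat)
    (beta : C) : C :=
  (RtoC ((-1) ^ m * INR m`!)
   * \big[Cplus/RtoC 0]_(j : n.-tuple 'I_m.+1 | sumn (map val j) == m)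
       (RtoC (INR (B_coef k (map val j))) * Z (addc k (map val j)) beta))%C.

(* Main.v *)
(* Let sigma x = 1 - x with psi x = 1 / (1 - x) for Li, and sigma x =
   (1 - x) / (1 + x) with psi x = 2 / (1 - x^2) for A; sigma is called [swap]
   below.  Then (log sigma)' = - psi, and the substitution u = sigma x exchanges
   the two forms dx / x and psi x dx of the iterated integral of Li or A.  In
   the word of k, the letters are therefore read in the dual order: one
   integrates by parts one letter at a time, differentiating the polylogarithm
   and integrating the cofactor, which starts as u^(-a) log^m u.  A letter dx / x
   turns the cofactor into the integral of psi u du times itself (a new leading
   index of the dual), the other letter into its integral against du / u (which
   increments the leading index).  To handle log^m u one works with u^(eps - a)
   and extracts the coefficient of eps^m; this produces the binomial weights.

   Each psi u is replaced by a truncation of its power series such that the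
   cofactor only involves u^(n - a) with n < N.  The boundary terms then give
   exactly the partial sum n_1 < N of the dual series, and the error is
   O(sqrt N) (1 - x)^(N - N0), whose integral is O(1 / sqrt N).  This yields the
   convergence of the integral together with its value.

   For the continuation in a, the terms of the dual series and their first
   order expansions in a are dominated, locally uniformly, by a convergent
   series. *)
From HB Require Import structures.
Require Import Defs.
From Stdlib Require Import Reals Lra.
From Coquelicot Require Import Coquelicot.
From mathcomp Require Import ssreflect ssrfun ssrbool eqtype ssrnat seq path.
From mathcomp Require Import div choice fintype tuple bigop binomial.
From mathcomp Require Import zify.

Set Implicit Arguments.
Unset Strict Implicit.
Unset Printing Implicit Defensive.

Local Open Scope nat_scope.

(** * Words and Hoffman duality *)

(** Truncation is what keeps the argument elementary. An untruncated cofactor is an infinite series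
    in u, and its boundary value is taken at u = 1, where convergence is worst; for finite N every
    cofactor is a finite sum and no limit has to be exchanged with an integral. The price is an
    error governed by sums of coefficients up to N. These grow at most like powers of log N, but the
    bound sqrt N is preferred: it reproduces itself when a further factor 1 / n is inserted, and it
    still loses against the 1 / (N - N0 + 1) obtained by integrating (1 - x)^(N - N0). The offset N0
    pays for the powers of 1 / u that the estimates spend on u^(-a), on logarithms and on 1 / x. The
    cofactors are written in y = log u, where du / u is dy and the coefficient of eps^q in u^eps is
    y^q / q!. Words with leading entry 0 occur as intermediate states, since a letter psi dx is a
    convolution with the coefficients of psi. *)

Lemma partial_sums_cons e k : k != [::] ->
  partial_sums (e :: k) = e :: map (addn e) (partial_sums k).
Proof.
case: k => [//|f k] _; rewrite /partial_sums /dep /= addn0.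
congr cons; rewrite -map_comp -[2]add1n iotaDl -map_comp.
by apply/eq_in_map => j.
Qed.

Lemma partial_sums_plus_head k :
  partial_sums (plus_head k) = map S (partial_sums k).
Proof.
case: k => [//|f k]; rewrite /partial_sums /dep /= -map_comp.
by apply/eq_in_map => j; rewrite mem_iota /= => /andP[j0 _]; case: j j0.
Qed.

Lemma weight_plus_head k : k != [::] -> weight (plus_head k) = (weight k).+1.
Proof. by case: k. Qed.

Lemma partial_sums_ones i k : k != [::] ->
  partial_sums (ncons i 1 k) = iota 1 i ++ map (addn i) (partial_sums k).
Proof.
move=> k0; elim: i => [|i IH].
  by rewrite /= -[LHS]map_id; apply/eq_map.
rewrite partial_sums_cons; last by case: i {IH}.
rewrite IH map_cat -map_comp /= -(iotaDl 1 1 i); congr (_ :: _ ++ _).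
Qed.

Lemma weight_ones i k : weight (ncons i 1 k) = i + weight k.
Proof. by elim: i => [//|i IH]; rewrite /weight /= -/(weight _) IH. Qed.

(** Prepending [e.+1] shifts the partial sums of [k] by [e.+1] and adds [e.+1] itself. The
    complement is 1, ..., e, produced by the leading ones, together with the shifted complement of
    [k]: [e] ones and the unit of [plus_head] shift by [e.+1] again. *)
Lemma is_hoffman_dual_cons e k d : is_hoffman_dual k d ->
  is_hoffman_dual (e.+1 :: k) (ncons e 1 (plus_head d)).
Proof.
case=> /andP[d0 dp] wd pd; have pd0 : plus_head d != [::] by case: d d0 {dp wd pd}.
have k0 : k != [::].
  apply: contraL dp => /eqP k0; move: wd; rewrite k0; clear -d0.
  case: d d0 => [//|f d] _; rewrite /weight /= => /eqP.
  by rewrite addn_eq0 => /andP[/eqP -> _]; rewrite inE eqxx.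
have w0 : 0 < weight k.
  rewrite -wd; case: d d0 dp {wd pd pd0} => [//|f d] _.
  by rewrite inE negb_or eq_sym -lt0n /weight /= => /andP[f0 _]; rewrite addn_gt0 f0.
split.
- apply/andP; split; first by case: e => //; case: d d0 {dp wd pd pd0}.
  elim: e => [|e IH] /=; last by rewrite inE.
  by case: d d0 dp {wd pd pd0} => // f d _; rewrite !inE !negb_or => /andP[].
- rewrite weight_ones weight_plus_head // wd /weight /=; lia.
- rewrite partial_sums_cons // partial_sums_ones // partial_sums_plus_head.
  have -> : [seq e + i | i <- [seq i.+1 | i <- partial_sums d]]
            = [seq e.+1 + i | i <- partial_sums d].
    by rewrite -map_comp; apply/eq_map => i /=; rewrite addnS.
  have -> : (weight (e.+1 :: k)).-1 = e + 1 + (weight k).-1.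
    by rewrite /weight /= -/(weight k); lia.
  rewrite !iotaD /= -catA -cat1s catA perm_sym.
  have -> : iota (1 + (e + 1)) (weight k).-1 = map (addn e.+1) (iota 1 (weight k).-1).
    by rewrite -iotaDl addnA addn1 addnC.
  rewrite -catA perm_catCA perm_cat2l.
  rewrite perm_sym perm_catCA perm_cat2l -map_cat.
  exact: perm_map pd.
Qed.

Lemma is_hoffman_dual_singleton e : is_hoffman_dual [:: e.+1] (nseq e.+1 1).
Proof.
split; first by apply/andP; split=> //; elim: e => // e IH; rewrite inE.
- by rewrite /weight sumn_nseq mul1n /= addn0.
have -> : nseq e.+1 1 = ncons e 1 [:: 1] by elim: e => //= e ->.
by rewrite partial_sums_ones // /weight /= addn0 cats0.
Qed.

(* Reads a composition from the left as a word in x = dt/t and y: the letter x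
   becomes a new leading entry 1 of the dual, the letter y increments the
   leading entry. *)
Definition dual_word (K k : seq nat) : seq nat :=
  foldl (fun K e => plus_head (ncons e.-1 1 K)) K k.

(** [foldl] on [k] is [foldr] on [rev k], hence the reversal; each entry then acts as in
    [is_hoffman_dual_cons]. The starting entry 1 is the letter dx / x supplied by the factor 1 / x
    of the integrand, which is why the weight of the result exceeds that of [k] by one. *)
Lemma dual_word_hoffman k : is_composition k ->
  dual_word [:: 1] k = plus_head (hoffman_dual (rev k)).
Proof.
move=> /andP[k0 kp].
rewrite /dual_word -[in LHS](revK k) foldl_rev.
have: 0 \notin rev k by rewrite mem_rev.
have: rev k != [::] by rewrite -size_eq0 size_rev size_eq0.
elim: (rev k) => {k k0 kp} [//|e k IH] _; rewrite inE negb_or => /andP[e0 kp] /=.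
case: e e0 => // e _ /=.
have ck : is_composition (e.+1 :: k) by rewrite /is_composition inE negb_or kp.
congr plus_head; apply: (@hoffman_dual_uniq (e.+1 :: k)); last exact: hoffman_dualP.
case: k => [|f k] in IH kp ck *.
  have -> : ncons e 1 [:: 1] = nseq e.+1 1 by elim: (e) => //= e' ->.
  exact: is_hoffman_dual_singleton.
rewrite IH //; apply: is_hoffman_dual_cons; apply: hoffman_dualP.
by rewrite /is_composition kp.
Qed.

Lemma size_plus_head k : size (plus_head k) = size k.
Proof. by case: k. Qed.

Lemma size_dual_word K k : 0 \notin k ->
  size (dual_word K k) + size k = size K + sumn k.
Proof.
elim: k K => [//|e k IH] K; rewrite inE negb_or => /andP[e0 kp] /=.
have := IH (plus_head (ncons e.-1 1 K)) kp; rewrite /dual_word /=.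
by rewrite size_plus_head size_ncons; lia.
Qed.

(** * Multiple polylogarithms as power series *)

HB.instance Definition _ := Monoid.isComLaw.Build R 0%R Rplus
  (fun x y z => esym (Rplus_assoc x y z)) Rplus_comm Rplus_0_l.
HB.instance Definition _ := Monoid.isMulLaw.Build R 0%R Rmult Rmult_0_l Rmult_0_r.
HB.instance Definition _ := Monoid.isAddLaw.Build R Rmult Rplus
  Rmult_plus_distr_r Rmult_plus_distr_l.
HB.instance Definition _ := Monoid.isComLaw.Build C (RtoC 0) Cplus
  Cplus_assoc Cplus_comm Cplus_0_l.
HB.instance Definition _ := Monoid.isMulLaw.Build C (RtoC 0) Cmult Cmult_0_l Cmult_0_r.
HB.instance Definition _ := Monoid.isAddLaw.Build C Cmult Cplus
  Cmult_plus_distr_r Cmult_plus_distr_l.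

Local Notation "\rsum_ ( i < n ) F" := (\big[Rplus/0%R]_(i < n) F%R)
  (at level 41, F at level 41, i, n at level 50).
Local Notation "\csum_ ( i < n ) F" := (\big[Cplus/RtoC 0]_(i < n) F%C)
  (at level 41, F at level 41, i, n at level 50).

Local Open Scope R_scope.

Lemma rsum_ge0 N (f : 'I_N -> R) : (forall n, 0 <= f n) ->
  0 <= \rsum_(n < N) f n.
Proof.
move=> f0; apply: big_ind => [|x y|i _]; [lra|lra|].
exact: f0.
Qed.

Lemma rsum_le N (f g : 'I_N -> R) : (forall n, f n <= g n) ->
  \rsum_(n < N) f n <= \rsum_(n < N) g n.
Proof.
move=> fg; apply: (big_ind2 (fun x y => x <= y)) => [|x y z t|i _]; [lra|lra|].
exact: fg.
Qed.

Lemma sum_nE (f : nat -> R) N : sum_n f N = \rsum_(n < N.+1) f n.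
Proof.
elim: N => [|N IH]; first by rewrite sum_O big_ord_recl big_ord0 /= Rplus_0_r.
by rewrite sum_Sn IH [RHS]big_ord_recr.
Qed.

Lemma INR_S_gt0 n : 0 < INR n.+1.
Proof. exact/lt_0_INR/Nat.lt_0_succ. Qed.

Section Weights.

Variable b : bool.

(* The case b = false is the one of Li and zeta, b = true the one of A and T. *)
Definition gap_weight (d : nat) : R := if b then (if odd d then 2 else 0) else 1.
Definition weight_at (r n : nat) : R := if b then (if odd (r + n) then 0 else 2) else 1.
Definition swap (x : R) : R := if b then (1 - x) / (1 + x) else 1 - x.
Definition psi (x : R) : R := if b then 2 / (1 - x * x) else / (1 - x).

(** The coefficient of x^n in Li or A, collecting the terms with n_1 = n. The empty word acts as a
    virtual last index 0. The condition n_j = r + 1 - j mod 2 compares n_j with the size of the word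
    from position j on. *)
Fixpoint coef (k : seq nat) (n : nat) : R :=
  if k is e :: k' then
    weight_at (size k) n / INR n ^ e * \rsum_(i < n) coef k' i
  else if n == 0%N then 1 else 0.

Lemma coef_cons e k n :
  coef (e :: k) n = weight_at (size k).+1 n / INR n ^ e * \rsum_(i < n) coef k i.
Proof. by []. Qed.

Lemma weight_at_ge0 r n : 0 <= weight_at r n.
Proof. rewrite /weight_at; case: b; [case: odd|]; lra. Qed.

Lemma weight_at_le r n : weight_at r n <= 2.
Proof. rewrite /weight_at; case: b; [case: odd|]; lra. Qed.

Lemma gap_weight_ge0 d : 0 <= gap_weight d.
Proof. rewrite /gap_weight; case: b; [case: odd|]; lra. Qed.

(* The parity of n is determined by that of i, which is fixed by the weight of i. *)
Lemma weight_atS r n i : (i < n)%N ->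
  weight_at r.+1 n * weight_at r i = gap_weight (n - i) * weight_at r i.
Proof.
rewrite /weight_at /gap_weight => lin; case: b => //.
rewrite oddB 1?ltnW // !oddD oddS.
by case: (odd r); case: (odd n); case: (odd i) => /=; lra.
Qed.

Lemma coef_weight k n :
  exists x, coef k n = weight_at (size k) n * x.
Proof.
case: k => [|e k] /=; last first.
  by exists (/ INR n ^ e * \rsum_(i < n) coef k i); rewrite /Rdiv Rmult_assoc.
case: eqP => [->|_]; last by exists 0; lra.
by rewrite /weight_at /=; case: b; [exists (/2)|exists 1]; lra.
Qed.

(** Reading the parity from gaps instead of residues makes a leading entry 0 a convolution with the
    coefficients of x psi x. *)
Lemma coef_head0 k n : coef (0%N :: k) n = \rsum_(i < n) (gap_weight (n - i) * coef k i).
Proof.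
rewrite /= /Rdiv Rinv_1 Rmult_1_r big_distrr /=; apply: eq_bigr => i _.
have [x ->] := coef_weight k i.
by rewrite -!Rmult_assoc weight_atS.
Qed.

Lemma coef_headS e k n : (0 < n)%N -> INR n * coef (e.+1 :: k) n = coef (e :: k) n.
Proof.
case: n => // n _; have n0 := INR_S_gt0 n.
rewrite !coef_cons.
by rewrite -tech_pow_Rmult; field; split; [apply: pow_nonzero; lra|lra].
Qed.

Lemma coef_ge0 k n : 0 <= coef k n.
Proof.
elim: k n => [|e k IH] n; first by rewrite /=; case: eqP; lra.
case: n => [|n]; first by rewrite /= big_ord0; lra.
apply: Rmult_le_pos; last by apply: rsum_ge0.
apply: Rmult_le_pos; first exact: weight_at_ge0.
by apply/Rlt_le/Rinv_0_lt_compat/pow_lt/INR_S_gt0.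
Qed.

Lemma coef_at0 e k : coef (e :: k) 0 = 0.
Proof. by rewrite /= big_ord0; lra. Qed.

(** The induction step amounts to (y - x)^2 >= 0 for the square roots x, y of N and N + 1. *)
Lemma inv_sqrt_sum N : \rsum_(n < N) (/ sqrt (INR n.+1)) <= 2 * sqrt (INR N).
Proof.
elim: N => [|N IH]; first by rewrite big_ord0 sqrt_0; lra.
rewrite big_ord_recr /=; apply: Rle_trans (Rplus_le_compat_r _ _ _ IH) _.
rewrite -/(INR N.+1) S_INR; set x := sqrt (INR N).
have N0 := pos_INR N.
have x0 : 0 <= x by apply: sqrt_pos.
have xx : x * x = INR N by apply: sqrt_sqrt.
set y := sqrt (INR N + 1).
have y0 : 0 < y by apply: sqrt_lt_R0; lra.
have yy : y * y = INR N + 1 by apply: sqrt_sqrt; lra.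
apply: (Rmult_le_reg_r y) => //.
rewrite Rmult_plus_distr_r Rinv_l; nra.
Qed.

(** The square root survives the induction: the new coefficient is at most 2 / n * M sqrt n = 2 M /
    sqrt n, and these sum to 4 M sqrt N. *)
Lemma coef_sum_le k : 0%N \notin k -> exists M, 0 <= M /\
  forall N, \rsum_(n < N) coef k n <= M * sqrt (INR N).
Proof.
elim: k => [_|e k IH].
  exists 1; split; first lra.
  case=> [|N]; first by rewrite big_ord0 sqrt_0; lra.
  rewrite big_ord_recl big1 // Rplus_0_r Rmult_1_l -[X in X <= _]sqrt_1.
  by apply: sqrt_le_1_alt; rewrite S_INR; have := pos_INR N; lra.
rewrite inE negb_or eq_sym -lt0n => /andP[e0 /IH[M [M0 HM]]].
exists (4 * M); split; first lra; move=> N.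
case: N => [|N]; first by rewrite big_ord0 sqrt_0; lra.
rewrite big_ord_recl coef_at0 Rplus_0_l.
apply: (Rle_trans _ (\rsum_(n < N) ((2 * M) * / sqrt (INR n.+1)))).
  apply: rsum_le => n; rewrite lift0.
  rewrite coef_cons.
  have n1 : 1 <= INR n.+1 by rewrite S_INR; have := pos_INR n; lra.
  have s0 : 0 < sqrt (INR n.+1) by apply: sqrt_lt_R0; lra.
  have ss : sqrt (INR n.+1) * sqrt (INR n.+1) = INR n.+1 by apply: sqrt_sqrt; lra.
  have -> : 2 * M * / sqrt (INR n.+1) = 2 / INR n.+1 * (M * sqrt (INR n.+1)).
    by rewrite -{2}ss; field; lra.
  apply: Rmult_le_compat => //.
  - apply: Rmult_le_pos; first exact: weight_at_ge0.
    by apply/Rlt_le/Rinv_0_lt_compat/pow_lt; lra.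
  - by apply: rsum_ge0 => i; apply: coef_ge0.
  - apply: Rmult_le_compat; [exact: weight_at_ge0| |exact: weight_at_le|].
      by apply/Rlt_le/Rinv_0_lt_compat/pow_lt; lra.
    apply: Rinv_le_contravar; first lra.
    case: e e0 => // e _; rewrite -tech_pow_Rmult -[X in X <= _]Rmult_1_r.
    apply: Rmult_le_compat_l; [lra|exact: pow_R1_Rle].
rewrite -big_distrr.
apply: Rle_trans (Rmult_le_compat_l _ _ _ _ (inv_sqrt_sum N)) _; first lra.
have -> : 2 * M * (2 * sqrt (INR N)) = 4 * M * sqrt (INR N) by ring.
apply: Rmult_le_compat_l; first lra.
by apply: sqrt_le_1_alt; rewrite S_INR; lra.
Qed.

Lemma inv_pow_le n e f : (f <= e)%N -> / INR n.+1 ^ e <= / INR n.+1 ^ f.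
Proof.
move=> fe; have n0 := INR_S_gt0 n.
apply: Rinv_le_contravar; first exact: pow_lt.
by apply: Rle_pow; [rewrite S_INR; have := pos_INR n; lra|apply/leP].
Qed.

Lemma coef_le_head e f k n : (f <= e)%N -> coef (e :: k) n <= coef (f :: k) n.
Proof.
move=> fe; case: n => [|n]; first by rewrite !coef_at0; lra.
rewrite !coef_cons.
apply: Rmult_le_compat_r; first by apply: rsum_ge0 => i; apply: coef_ge0.
apply: Rmult_le_compat_l; first exact: weight_at_ge0.
exact: inv_pow_le.
Qed.

Lemma coef_le_sqrt e k : 0%N \notin k -> exists M, 0 <= M /\
  forall n, coef (e :: k) n.+1 <= M * sqrt (INR n.+1) / INR n.+1 ^ e.
Proof.
move=> /coef_sum_le[M [M0 HM]]; exists (2 * M); split; first lra; move=> n.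
have p0 := pow_lt _ e (INR_S_gt0 n); have s0 := sqrt_pos (INR n.+1).
rewrite coef_cons.
have -> : 2 * M * sqrt (INR n.+1) / INR n.+1 ^ e =
          2 / INR n.+1 ^ e * (M * sqrt (INR n.+1)) by field; lra.
apply: Rmult_le_compat; last exact: HM.
- apply: Rmult_le_pos; [exact: weight_at_ge0|exact/Rlt_le/Rinv_0_lt_compat].
- by apply: rsum_ge0 => i; apply: coef_ge0.
- apply: Rmult_le_compat_r; [exact/Rlt_le/Rinv_0_lt_compat|exact: weight_at_le].
Qed.

Lemma coef_bounded k : 0%N \notin k -> exists M, forall n, coef k n <= M.
Proof.
case: k => [_|e k]; first by exists 1 => n /=; case: eqP; lra.
rewrite inE negb_or eq_sym -lt0n => /andP[e0 /(coef_le_sqrt 1%N)[M [M0 HM]]].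
exists M => -[|n]; first by rewrite coef_at0.
apply: Rle_trans (coef_le_head k _ e0) _; apply: Rle_trans (HM n) _.
rewrite pow_1; set x := INR n.+1.
have x1 : 1 <= x by rewrite /x S_INR; have := pos_INR n; lra.
have s0 : 0 < sqrt x by apply: sqrt_lt_R0; lra.
have ss : sqrt x * sqrt x = x by apply: sqrt_sqrt; lra.
apply: (Rmult_le_reg_r x); first lra.
have -> : M * sqrt x / x * x = M * sqrt x by field; lra.
by apply: Rmult_le_compat_l => //; nra.
Qed.

Definition L (k : seq nat) (x : R) : R := PSeries (coef k) x.

Lemma coef_radius k x : 0%N \notin k -> Rabs x < 1 ->
  Rbar_lt (Rabs x) (CV_radius (coef k)).
Proof.
move=> /coef_bounded[M HM] x1.
apply: Rbar_lt_le_trans (proj1 (CV_radius_bounded (coef k)) 1 _) => //.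
exists M => n; rewrite pow1 Rmult_1_r Rabs_pos_eq //; exact: coef_ge0.
Qed.

Lemma ex_pseries_coef k x : 0%N \notin k -> Rabs x < 1 -> ex_pseries (coef k) x.
Proof. by move=> k0 x1; apply/CV_radius_inside/coef_radius. Qed.

Lemma is_derive_L e k x : 0%N \notin k -> 0 < x < 1 ->
  is_derive (L (e.+1 :: k)) x (L (e :: k) x / x).
Proof.
move=> k0 [x0 x1].
have r : Rbar_lt (Rabs x) (CV_radius (coef (e.+1 :: k))).
  by apply: coef_radius; rewrite ?inE // Rabs_pos_eq; lra.
have -> : L (e :: k) x / x = PSeries (PS_derive (coef (e.+1 :: k))) x.
  rewrite (_ : L (e :: k) x = PSeries (PS_incr_1 (PS_derive (coef (e.+1 :: k)))) x).
    by rewrite PSeries_incr_1; field; lra.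
  apply: PSeries_ext => -[|n]; first by rewrite coef_at0.
  by rewrite /PS_incr_1 /PS_derive coef_headS.
exact: is_derive_PSeries.
Qed.

(** For [b] only even d contribute, so the geometric series stops at the first even exponent not
    below N, which is N + odd N. *)
Lemma gap_weight_sum x N : Rabs x < 1 ->
  \rsum_(d < N) (gap_weight d.+1 * x ^ d) =
  (1 - x ^ (if b then N + odd N else N)%N) * psi x.
Proof.
move=> /Rabs_def2[x1 x2]; rewrite /gap_weight /psi.
have n1 : 1 - x <> 0 by lra.
have n2 : 1 - x * x <> 0 by nra.
elim: N => [|N IH]; first by rewrite big_ord0; case: b => /=; field.
rewrite big_ord_recr {}IH /=; case: b; last by rewrite /=; field.
case: (odd N) => /=.
  by rewrite addn0 addn1 /=; field.
by rewrite addn0 addn1 /=; field.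
Qed.

Lemma is_pseries_psi x : Rabs x < 1 -> is_pseries (fun d => gap_weight d.+1) x (psi x).
Proof.
move=> x1.
change (is_lim_seq (sum_n (fun d => scal (pow_n x d) (gap_weight d.+1))) (psi x)).
apply: (is_lim_seq_ext
  (fun N => (1 - x ^ (if b then N.+1 + odd N.+1 else N.+1)%N) * psi x)).
  move=> N; rewrite -gap_weight_sum // sum_nE; apply: eq_bigr => i _.
  by rewrite pow_n_pow Rmult_comm.
rewrite -{2}[psi x]Rmult_1_l -{2}(Rminus_0_r 1).
apply: is_lim_seq_mult'; last exact: is_lim_seq_const.
apply: is_lim_seq_minus'; first exact: is_lim_seq_const.
have := is_lim_seq_geom x x1; move/is_lim_seq_abs => H.
apply/is_lim_seq_abs_0.
apply: is_lim_seq_le_le (is_lim_seq_const 0) _ => [N|]; last first.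
  by move: H; rewrite /= Rabs_R0; exact.
split; first exact: Rabs_pos.
rewrite -!RPow_abs.
have := Rabs_pos x.
set y := Rabs x in x1 *.
move=> y0.
have le i : y ^ (N + i) <= y ^ N.
  rewrite pow_add -[X in _ <= X]Rmult_1_r; apply: Rmult_le_compat_l; first exact: pow_le.
  by rewrite -(pow1 i); apply: pow_incr; lra.
case: b; last by rewrite -addn1.
by rewrite addSnnS.
Qed.

(** A Cauchy product with the series of psi. With [is_derive_L] it gives psi L k as the derivative
    of L (1 :: k), the second letter of the iterated integral. *)
Lemma L_head0 k x : 0%N \notin k -> Rabs x < 1 -> L (0%N :: k) x = x * psi x * L k x.
Proof.
move=> k0 x1.
rewrite (_ : L _ _ = PSeries (PS_incr_1 (PS_mult (coef k) (fun d => gap_weight d.+1))) x).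
  have r : Rbar_lt (Rabs x) (CV_radius (fun d => gap_weight d.+1)).
    apply: Rbar_lt_le_trans (proj1 (CV_radius_bounded (fun d => gap_weight d.+1)) 1 _) => //.
    exists 2 => n; rewrite pow1 Rmult_1_r Rabs_pos_eq; last exact: gap_weight_ge0.
    by rewrite /gap_weight; case: b; [case: odd|]; lra.
  rewrite PSeries_incr_1 PSeries_mult //; last exact: coef_radius.
  by rewrite (is_pseries_unique _ _ _ (is_pseries_psi x1)) /L; ring.
apply: PSeries_ext => -[|n]; first by rewrite coef_at0.
rewrite coef_head0 /PS_incr_1 /PS_mult -sum_n_Reals sum_nE.
apply: eq_bigr => i _; rewrite Rmult_comm; congr (_ * gap_weight _).
by have := ltn_ord i; lia.
Qed.

End Weights.

(** * Growth of the polylogarithms at the endpoints *)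

Lemma PSeries_nonneg_le (p q : nat -> R) x : 0 <= x ->
  (forall n, 0 <= p n <= q n) -> ex_pseries q x -> PSeries p x <= PSeries q x.
Proof.
move=> x0 pq /ex_pseries_R eq; apply: Series_le => // n.
have xn := pow_le _ n x0; have := pq n; nra.
Qed.

Section PolylogBounds.

Variable b : bool.

(** Also the polylogarithm of the word [:: 1]; as x runs from 0 to 1 it increases from 0 to
    infinity. *)
Definition ell (x : R) : R := - ln (swap b x).

Lemma swap_bounds x : 0 < x < 1 -> 0 < swap b x < 1 /\ swap b x <= 1 - x.
Proof.
move=> x01; rewrite /swap; case: b; last lra.
have i0 : 0 < / (1 + x) by apply: Rinv_0_lt_compat; lra.
have i1 : (1 + x) * / (1 + x) = 1 by field; lra.
rewrite /Rdiv; nra.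
Qed.

Lemma swap_0 : swap b 0 = 1.
Proof. by rewrite /swap; case: b; field. Qed.

Lemma is_derive_swap x : 0 <= x < 1 ->
  is_derive (swap b) x (- (swap b x * psi b x)).
Proof.
move=> x01; rewrite /swap /psi; case: b.
  by auto_derive; [lra|field; split; [nra|lra]].
by auto_derive; [|field; lra].
Qed.

Lemma is_derive_ell x : 0 <= x < 1 -> is_derive ell x (psi b x).
Proof.
move=> x01; have s0 : 0 < swap b x.
  have [->|x0] := Req_dec x 0; first by rewrite swap_0; lra.
  by have [] := @swap_bounds x; lra.
have H := is_derive_comp ln (swap b) x _ _ (is_derive_ln _ s0) (is_derive_swap x01).
apply: (is_derive_ext_loc (fun x => - ln (swap b x))); first by apply: filter_forall.
have -> : psi b x = opp (scal (- (swap b x * psi b x)) (/ swap b x)).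
  by rewrite /opp /scal /= /mult /=; field; lra.
exact: is_derive_opp.
Qed.

Lemma ell_0 : ell 0 = 0.
Proof. by rewrite /ell swap_0 ln_1 Ropp_0. Qed.

Lemma ell_gt0 x : 0 < x < 1 -> 0 < ell x.
Proof.
move=> /swap_bounds[[s0 s1] _]; have := ln_increasing _ _ s0 s1.
by rewrite ln_1 /ell; lra.
Qed.

(** For s = sigma x this combines - log s <= 1 / s - 1 with 1 - s <= 2 x. *)
Lemma ell_le x : 0 < x < 1 -> ell x / x <= 2 / swap b x.
Proof.
move=> x01; have [[s0 s1] _] := swap_bounds x01.
have le : ell x <= / swap b x - 1.
  rewrite /ell -ln_Rinv //; have := exp_ineq1_le (ln (/ swap b x)).
  by rewrite exp_ln; [lra|exact: Rinv_0_lt_compat].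
apply: (Rle_trans _ ((/ swap b x - 1) / x)).
  by apply: Rmult_le_compat_r => //; apply/Rlt_le/Rinv_0_lt_compat; lra.
apply: (Rmult_le_reg_r (swap b x)) => //.
have -> : 2 / swap b x * swap b x = 2 by field; lra.
have -> : (/ swap b x - 1) / x * swap b x = (1 - swap b x) / x by field; lra.
apply: (Rmult_le_reg_r x); first lra.
have -> : (1 - swap b x) / x * x = 1 - swap b x by field; lra.
rewrite /swap; case: b; last lra.
apply: (Rmult_le_reg_r (1 + x)); first lra.
have -> : (1 - (1 - x) / (1 + x)) * (1 + x) = 2 * x by field; lra.
nra.
Qed.

Lemma psi_ge0 x : 0 <= x < 1 -> 0 <= psi b x.
Proof.
move=> x01; rewrite /psi; case: b.
  by apply: Rmult_le_pos; [lra|apply/Rlt_le/Rinv_0_lt_compat; nra].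
by apply/Rlt_le/Rinv_0_lt_compat; lra.
Qed.

(** For u = sigma x one has du = - u psi(x) dx, so this is the exchange of forms: psi(u) du becomes
    - dx / x. *)
Lemma psi_swap x : 0 < x < 1 -> psi b x * (swap b x * psi b (swap b x)) = / x.
Proof.
move=> x01; rewrite /psi /swap; case: b; last by field; lra.
have -> : 1 - (1 - x) / (1 + x) * ((1 - x) / (1 + x)) = 4 * x / ((1 + x) * (1 + x)).
  by field; lra.
by field; do ?split; try lra; nra.
Qed.

Lemma L_ge0 k x : 0%N \notin k -> 0 <= x < 1 -> 0 <= L b k x.
Proof.
move=> k0 x01; rewrite -(PSeries_const_0 x).
apply: PSeries_nonneg_le; [lra| |].
  by move=> n; have := coef_ge0 b k n; lra.
by apply: ex_pseries_coef => //; rewrite Rabs_pos_eq; lra.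
Qed.

Lemma L_nil x : Rabs x < 1 -> L b [::] x = 1.
Proof.
move=> x1; rewrite /L PSeries_decr_1; last exact: ex_pseries_coef.
rewrite (PSeries_ext _ (fun=> 0)) // PSeries_const_0 /=; ring.
Qed.

Lemma L_0 e k : L b (e :: k) 0 = 0.
Proof. by rewrite /L PSeries_0 coef_at0. Qed.

Lemma continuous_L k x : 0%N \notin k -> Rabs x < 1 -> continuity_pt (L b k) x.
Proof. by move=> k0 x1; apply/PSeries_continuity/coef_radius. Qed.

(** Lowering the leading entry to 1 only increases the coefficients. Then two functions vanishing at
    0 are compared through their derivatives, psi L k and (r + 1) psi ell^r with r the size of the
    tail. *)
Lemma L_le_ell k x : 0%N \notin k -> 0 <= x < 1 -> L b k x <= ell x ^ size k.
Proof.
elim: k x => [|e k IH] x; first by move=> _ x01; rewrite L_nil /=; [lra|rewrite Rabs_pos_eq; lra].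
rewrite inE negb_or eq_sym -lt0n => /andP[e0 k0] x01.
apply: (Rle_trans _ (L b (1%N :: k) x)).
  apply: PSeries_nonneg_le; first lra.
    by move=> n; split; [exact: coef_ge0|exact: coef_le_head].
  by apply: ex_pseries_coef; rewrite ?inE // Rabs_pos_eq; lra.
have [->|x0] := Req_dec x 0; first by rewrite L_0 ell_0 /= Rmult_0_l; lra.
pose g y := ell y ^ (size k).+1 - L b (1%N :: k) y.
pose dg y := psi b y * (INR (size k).+1 * ell y ^ size k - L b k y).
have [||c [c1]] := MVT_gen g 0 x dg.
- rewrite Rmin_left ?Rmax_right; try lra; move=> y y01.
  have -> : dg y = minus (INR (size k).+1 * psi b y * ell y ^ size k) (L b (0%N :: k) y / y).
    rewrite L_head0 ?Rabs_pos_eq //; try lra.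
    by rewrite /dg /minus /plus /opp /=; field; lra.
  apply: is_derive_minus; last by apply: is_derive_L => //; lra.
  have := @is_derive_pow ell (size k).+1 y (psi b y); apply.
  by apply: is_derive_ell; lra.
- rewrite Rmin_left ?Rmax_right; try lra; move=> y y01.
  apply: continuity_pt_minus; last by apply: continuous_L; rewrite ?inE // Rabs_pos_eq; lra.
  apply/continuity_pt_filterlim/ex_derive_continuous.
  exists (INR (size k).+1 * psi b y * ell y ^ size k).
  have := @is_derive_pow ell (size k).+1 y (psi b y); apply.
  by apply: is_derive_ell; lra.
move: c1; rewrite Rmin_left ?Rmax_right; try lra; move=> c1.
rewrite {2}/g L_0 ell_0 pow_ne_zero // Rminus_0_r Rminus_0_r => E.
suff : 0 <= g x by rewrite /g /=; lra.
rewrite E; apply: Rmult_le_pos; last lra.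
apply: Rmult_le_pos; first by apply: psi_ge0; lra.
have lc : 0 <= ell c.
  have [->|c0] := Req_dec c 0; first by rewrite ell_0; lra.
  by apply/Rlt_le/ell_gt0; lra.
have {}IH : L b k c <= ell c ^ size k by apply: IH => //; lra.
have pc := pow_le _ (size k) lc; have := pos_INR (size k); rewrite S_INR; nra.
Qed.

End PolylogBounds.

(** * Complex-valued functions of a real variable *)

Definition Cderive (f : R -> C) (x : R) (l : C) : Prop :=
  is_derive (fun x => Re (f x)) x (Re l) /\ is_derive (fun x => Im (f x)) x (Im l).

Lemma is_derive_eq (f : R -> R) (x k l : R) : is_derive f x k -> k = l -> is_derive f x l.
Proof. by move=> df <-. Qed.

Lemma Cderive_eq f x k l : Cderive f x k -> k = l -> Cderive f x l.
Proof. by move=> df <-. Qed.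

Lemma Cderive_const c x : Cderive (fun=> c) x (RtoC 0).
Proof. by split; apply: is_derive_const. Qed.

Lemma Cderive_plus f g x k l : Cderive f x k -> Cderive g x l ->
  Cderive (fun x => f x + g x)%C x (k + l)%C.
Proof.
move=> [fr fi] [gr gi]; split; first exact: is_derive_plus fr gr.
exact: is_derive_plus fi gi.
Qed.

Lemma is_derive_Rmult (f g : R -> R) (x k l : R) : is_derive f x k -> is_derive g x l ->
  is_derive (fun x => f x * g x) x (k * g x + f x * l).
Proof. by move=> df dg; apply: (is_derive_mult f g x k l df dg Rmult_comm). Qed.

Lemma Cderive_mult f g x k l : Cderive f x k -> Cderive g x l ->
  Cderive (fun x => f x * g x)%C x (k * g x + f x * l)%C.
Proof.
move=> [fr fi] [gr gi]; split.
  by apply: is_derive_eq (is_derive_minus _ _ _ _ _ (is_derive_Rmult fr gr) (is_derive_Rmult fi gi)) _; rewrite /minus /plus /opp /Re /Im /=; ring.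
by apply: is_derive_eq (is_derive_plus _ _ _ _ _ (is_derive_Rmult fr gi) (is_derive_Rmult fi gr)) _; rewrite /plus /Re /Im /=; ring.
Qed.

Lemma Cderive_RtoC (f : R -> R) x l : is_derive f x l ->
  Cderive (fun x => RtoC (f x)) x (RtoC l).
Proof. by move=> df; split=> //; apply: is_derive_const. Qed.

Lemma Cderive_comp f (g : R -> R) x k l : Cderive f (g x) k -> is_derive g x l ->
  Cderive (fun x => f (g x)) x (RtoC l * k)%C.
Proof.
move=> [fr fi] dg; split.
  by apply: is_derive_eq (is_derive_comp _ _ _ _ _ fr dg) _; rewrite /scal /Re /Im /= /mult /=; ring.
by apply: is_derive_eq (is_derive_comp _ _ _ _ _ fi dg) _; rewrite /scal /Re /Im /= /mult /=; ring.
Qed.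

Lemma Cderive_sum N (f : 'I_N -> R -> C) x l : (forall i, Cderive (f i) x (l i)) ->
  Cderive (fun x => \csum_(i < N) f i x) x (\csum_(i < N) l i).
Proof.
elim: N f l => [|N IH] f l df.
  rewrite big_ord0; split; apply: (is_derive_ext (fun=> 0)) => [y|]; rewrite ?big_ord0 //;
  exact: is_derive_const.
have := Cderive_plus (df ord0) (IH _ _ (fun i => df (lift ord0 i))).
rewrite big_ord_recl => -[dr di]; split.
  by apply: is_derive_ext dr => y; rewrite big_ord_recl.
by apply: is_derive_ext di => y; rewrite big_ord_recl.
Qed.

Lemma Cmod_sum N (f : 'I_N -> C) : Cmod (\csum_(i < N) f i) <= \rsum_(i < N) Cmod (f i).
Proof.
apply: (big_ind2 (fun z x => Cmod z <= x)) => [|x y z t xy zt|i _].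
- by rewrite Cmod_0; lra.
- by apply: Rle_trans (Cmod_triangle _ _) _; lra.
- exact: Rle_refl.
Qed.

(** The coefficient of eps^q in exp ((s + eps) y). *)
Definition expmon (q : nat) (s : C) (y : R) : C :=
  (cexp (s * RtoC y) * RtoC (y ^ q / INR q`!))%C.

Lemma Cderive_cexp s y : Cderive (fun y => cexp (s * RtoC y)) y (s * cexp (s * RtoC y))%C.
Proof.
by case: s => u v; rewrite /cexp; split => /=; auto_derive => //=; rewrite /Rminus; ring.
Qed.

Lemma Cderive_expmon0 s y : Cderive (expmon 0 s) y (s * expmon 0 s y)%C.
Proof.
apply: Cderive_eq (Cderive_mult (Cderive_cexp s y) (Cderive_const (RtoC (1 / 1)) y)) _.
by rewrite /expmon /=; ring.
Qed.

Lemma INR_fact_gt0 q : 0 < INR q`!.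
Proof. by apply: lt_0_INR; apply/ltP; rewrite fact_gt0. Qed.

Lemma Cderive_expmonS q s y :
  Cderive (expmon q.+1 s) y (s * expmon q.+1 s y + expmon q s y)%C.
Proof.
have dp : is_derive (fun y => y ^ q.+1 / INR q.+1`!) y (y ^ q / INR q`!).
  have f0 := INR_fact_gt0 q; have q0 := INR_S_gt0 q.
  have -> : y ^ q / INR q`! = INR q.+1 * 1 * y ^ q * / INR q.+1`!.
    by rewrite factS mult_INR; field; lra.
  apply: is_derive_scal_l.
  by have := @is_derive_pow id q.+1 y 1 (is_derive_id _).
by apply: Cderive_eq (Cderive_mult (Cderive_cexp s y) (Cderive_RtoC dp)) _; rewrite /expmon; ring.
Qed.

Lemma cexp_plus z w : cexp (z + w) = (cexp z * cexp w)%C.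
Proof.
case: z w => [z1 z2] [w1 w2]; rewrite /cexp /= exp_plus cos_plus sin_plus.
by rewrite /Cmult /=; congr pair; ring.
Qed.

Lemma cexp_RtoC x : cexp (RtoC x) = RtoC (exp x).
Proof. by rewrite /cexp /= cos_0 sin_0 Rmult_1_r Rmult_0_r. Qed.

Lemma Cmod_cexp z : Cmod (cexp z) = exp (Re z).
Proof.
rewrite /Cmod /cexp /=.
have -> : exp (Re z) * cos (Im z) * (exp (Re z) * cos (Im z) * 1) +
          exp (Re z) * sin (Im z) * (exp (Re z) * sin (Im z) * 1) =
          (exp (Re z))² * ((sin (Im z))² + (cos (Im z))²) by rewrite /Rsqr; ring.
by rewrite sin2_cos2 Rmult_1_r sqrt_Rsqr //; apply/Rlt_le/exp_pos.
Qed.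

Lemma expmon_shift q n s y :
  expmon q (RtoC (INR n) + s) y = (RtoC (exp y ^ n) * expmon q s y)%C.
Proof.
rewrite /expmon Cmult_plus_distr_r cexp_plus -RtoC_mult cexp_RtoC.
have -> : exp (INR n * y) = exp y ^ n.
  elim: n => [|n IH]; first by rewrite Rmult_0_l exp_0.
  by rewrite S_INR Rmult_plus_distr_r Rmult_1_l exp_plus IH /= Rmult_comm.
ring.
Qed.

Lemma Cmod_expmon q s y : Cmod (expmon q s y) = exp (Re s * y) * (Rabs y ^ q / INR q`!).
Proof.
rewrite /expmon Cmod_mult Cmod_cexp Cmod_R; congr (exp _ * _); first by rewrite /Re /=; ring.
by rewrite Rabs_div ?RPow_abs ?(Rabs_pos_eq (INR _)) //; have := INR_fact_gt0 q; lra.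
Qed.

Lemma expmon_at0 q s : expmon q s 0 = if q == 0%N then RtoC 1 else RtoC 0.
Proof.
rewrite /expmon Cmult_0_r cexp_RtoC exp_0; case: q => [|q] /=.
  by rewrite Rdiv_1_r Cmult_1_r.
by rewrite Rmult_0_l /Rdiv Rmult_0_l Cmult_0_r.
Qed.

(** * Generating functions of the truncated dual sums *)

Section Dual.

Variables (b : bool) (a : C).

(* The coefficient of eps^j in (s + eps)^-e. *)
Definition binv (e j : nat) (s : C) : C :=
  (RtoC ((-1) ^ j * INR 'C(e + j - 1, j)) / s ^ (e + j))%C.

(* The coefficient of eps^p in coef k n with the factors n_i replaced by
   n_i - a + eps. *)
Fixpoint dcoef (k : seq nat) (p n : nat) : C :=
  if k is e :: k' then
    (RtoC (weight_at b (size k) n) *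
     \csum_(j < p.+1) (binv e j (RtoC (INR n) - a) * \csum_(i < n) dcoef k' (p - j)%N i))%C
  else if (n == 0)%N && (p == 0)%N then RtoC 1 else RtoC 0.

(** The coefficient of eps^(j+1) in (s + eps) (s + eps)^-(e+1) = (s + eps)^-e; on the binomials it
    is Pascal's rule. *)
Lemma binvS e j s : s <> RtoC 0 ->
  (s * binv e.+1 j.+1 s + binv e.+1 j s)%C = binv e j.+1 s.
Proof.
move=> s0; rewrite /binv.
have -> : (e.+1 + j.+1 - 1 = (e + j).+1)%N by lia.
have -> : (e.+1 + j - 1 = e + j)%N by lia.
have -> : (e + j.+1 - 1 = e + j)%N by lia.
have -> : (-1) ^ j.+1 = - (-1) ^ j by rewrite /=; ring.
rewrite binS plus_INR !RtoC_mult RtoC_plus RtoC_opp addnS addSn addnS.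
rewrite !Cpow_S; set c := RtoC (_ ^ j).
field; split=> //; exact: Cpow_nz.
Qed.

Lemma binv_0 e s : s <> RtoC 0 -> (s * binv e.+1 0 s)%C = binv e 0 s.
Proof.
move=> s0; rewrite /binv !addn0 !bin0 Cpow_S; field; split=> //; exact: Cpow_nz.
Qed.

Lemma binv_head0 j s : binv 0 j s = if j == 0%N then RtoC 1 else RtoC 0.
Proof.
case: j => [|j]; rewrite /binv /=; first by rewrite /= Rmult_1_l; field.
by rewrite subn1 bin_small // Rmult_0_r /Cdiv Cmult_0_l.
Qed.

(** Multiplication by eps, on coefficient sequences. *)
Definition dcoef_pred (k : seq nat) (p n : nat) : C :=
  if p is p'.+1 then dcoef k p' n else RtoC 0.

Lemma dcoef_cons e k p n : dcoef (e :: k) p n =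
  (RtoC (weight_at b (size k).+1 n) *
   \csum_(j < p.+1) (binv e j (RtoC (INR n) - a) * \csum_(i < n) dcoef k (p - j)%N i))%C.
Proof. by []. Qed.

Lemma dcoef_at0 e k p : dcoef (e :: k) p 0 = RtoC 0.
Proof.
rewrite dcoef_cons big1 ?Cmult_0_r // => j _.
by rewrite big_ord0 Cmult_0_r.
Qed.

Lemma dcoef_headS e k p n : (RtoC (INR n) - a)%C <> RtoC 0 ->
  ((RtoC (INR n) - a) * dcoef (e.+1 :: k) p n + dcoef_pred (e.+1 :: k) p n)%C =
  dcoef (e :: k) p n.
Proof.
set s := (RtoC (INR n) - a)%C => s0.
case: p => [|p]; rewrite /dcoef_pred !dcoef_cons -/s.
  rewrite !big_ord_recl !big_ord0 /= -(binv_0 e s0); ring.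
rewrite [in LHS]big_ord_recl [in RHS]big_ord_recl -(binv_0 e s0).
rewrite [X in _ = (_ * (_ + X))%C](eq_bigr (fun j : 'I_p.+1 =>
  s * (binv e.+1 (lift ord0 j) s * \csum_(i < n) dcoef k (p.+1 - lift ord0 j)%N i) +
  binv e.+1 j s * \csum_(i < n) dcoef k (p - j)%N i)%C); last first.
  move=> j _; rewrite lift0 subSS -(binvS e j s0); ring.
rewrite big_split -big_distrr /= subn0; ring.
Qed.

Lemma dcoef_weight k p n : exists z, dcoef k p n = (RtoC (weight_at b (size k) n) * z)%C.
Proof.
case: k => [|e k] /=; last by eexists.
case: eqP => [->|_]; last by exists (RtoC 0); rewrite Cmult_0_r.
exists ((if (p == 0)%N then RtoC 1 else RtoC 0) / RtoC (weight_at b 0 0))%C.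
rewrite /weight_at /=; case: b; case: eqP => _ /=; field; move/RtoC_inj; lra.
Qed.

Arguments dcoef : simpl never.

Lemma dcoef_head0 k p n :
  dcoef (0%N :: k) p n = \csum_(i < n) (RtoC (gap_weight b (n - i)) * dcoef k p i).
Proof.
rewrite dcoef_cons big_ord_recl [X in (_ * (_ + X))%C]big1 => [|j _]; last by rewrite lift0 binv_head0 Cmult_0_l.
rewrite binv_head0 Cplus_0_r Cmult_1_l subn0 big_distrr /=; apply: eq_bigr => i _.
have [z ->] := dcoef_weight k p i.
by rewrite !Cmult_assoc -!RtoC_mult weight_atS.
Qed.

Section LogSum.

Variable m : nat.

(* With u = exp y, the coefficient of eps^m in the sum over n < N of
   u^(n - a + eps) times the power series in eps with coefficients dcoef k p n. *)
Definition dsum (N : nat) (k : seq nat) (y : R) : C :=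
  \csum_(n < N) \csum_(p < m.+1) (dcoef k p n * expmon (m - p) (RtoC (INR n) - a) y).

Lemma Cderive_expmon q s y :
  Cderive (expmon q s) y (s * expmon q s y + (if q is q'.+1 then expmon q' s y else RtoC 0))%C.
Proof.
case: q => [|q]; last exact: Cderive_expmonS.
by apply: Cderive_eq (Cderive_expmon0 s y) _; rewrite Cplus_0_r.
Qed.

(** A factor eps may be charged to the exponential or to the coefficient. *)
Lemma dsum_shift k n s y : 
  \csum_(p < m.+1) (dcoef k p n * (if (m - p)%N is q.+1 then expmon q s y else RtoC 0)) =
  \csum_(p < m.+1) (dcoef_pred k p n * expmon (m - p) s y).
Proof.
rewrite [LHS]big_ord_recr [RHS]big_ord_recl /= subnn Cmult_0_r Cmult_0_l Cplus_0_l Cplus_0_r.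
apply: eq_bigr => p _; rewrite /bump /= add1n /=.
by have -> : (m - p = (m - p.+1).+1)%N by have := ltn_ord p; lia.
Qed.

(** The derivative of exp ((n - a + eps) y) brings down n - a + eps, which cancels one power of the
    leading factor. *)
Lemma Cderive_dsum N e k y : (forall n, (0 < n)%N -> (RtoC (INR n) - a)%C <> RtoC 0) ->
  Cderive (dsum N (e.+1 :: k)) y (dsum N (e :: k) y).
Proof.
move=> na; rewrite /dsum; apply: Cderive_sum => -[n nN] /=; set s := (_ - a)%C.
apply: Cderive_eq.
  apply: Cderive_sum => p; apply: Cderive_mult; first exact: Cderive_const.
  exact: Cderive_expmon.
rewrite [LHS](eq_bigr (fun p : 'I_m.+1 =>
    dcoef (e.+1 :: k) p n * (s * expmon (m - p) s y) +
    dcoef (e.+1 :: k) p n *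
      (if (m - p)%N is q.+1 then expmon q s y else RtoC 0))%C); last first.
  by move=> p _; ring.
rewrite big_split /= dsum_shift -big_split; apply: eq_bigr => p _ /=.
(* At n = 0 the inner sum is empty and all coefficients vanish, so the zero of n - a at a = 0 does
   no harm. *)
have [n0|n0] := posnP n.
  by rewrite n0 !dcoef_at0 /dcoef_pred; case: (nat_of_ord p) => [|q]; rewrite ?dcoef_at0; ring.
by rewrite -(@dcoef_headS e k p n) -/s; [ring|exact: na].
Qed.

(** The missing tail of the geometric series starts at x^N, or at x^(N+1) when parity skips one
    exponent. *)
Lemma gap_weight_tail x i N : 0 < x < 1 -> (i < N)%N ->
  0 <= x ^ i * (x * psi b x) -
     \rsum_(n < N) (if (i < n)%N then gap_weight b (n - i) * x ^ n else 0) <=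
  x ^ N * psi b x.
Proof.
move=> x01 iN.
have -> : \rsum_(n < N) (if (i < n)%N then gap_weight b (n - i) * x ^ n else 0) =
          x ^ i.+1 * \rsum_(d < (N - i.+1)) (gap_weight b d.+1 * x ^ d).
  elim: N iN => // N IH; rewrite ltnS leq_eqVlt => /orP[/eqP <-|iN].
    rewrite subnn big_ord0 Rmult_0_r big_ord_recr /= ltnn Rplus_0_r big1 // => j _.
    by rewrite ltnNge ltnW.
  rewrite big_ord_recr IH // subSn //= iN big_ord_recr /= Rmult_plus_distr_l.
  congr Rplus; rewrite -subnSK // -Rmult_assoc (Rmult_comm _ (gap_weight _ _)) Rmult_assoc.
  by rewrite -[x * x ^ i]/(x ^ i.+1) -pow_add; congr (_ * _ ^ _); lia.
rewrite gap_weight_sum; last by rewrite Rabs_pos_eq; lra.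
set e := if b then _ else _.
have -> : x ^ i * (x * psi b x) - x ^ i.+1 * ((1 - x ^ e) * psi b x) = x ^ (i.+1 + e) * psi b x.
  by rewrite pow_add /=; ring.
have p0 : 0 <= psi b x by apply: psi_ge0; lra.
split; first by apply: Rmult_le_pos => //; apply: pow_le; lra.
apply: Rmult_le_compat_r => //.
have -> : (i.+1 + e = N + (e - (N - i.+1)))%N by rewrite /e; case: b; lia.
rewrite pow_add -[X in _ <= X]Rmult_1_r; apply: Rmult_le_compat_l; first by apply: pow_le; lra.
by rewrite -(pow1 (e - (N - i.+1))); apply: pow_incr; lra.
Qed.

End LogSum.
End Dual.

Arguments dcoef : simpl never.

(** * Estimates for the dual coefficients and cofactors *)

Lemma not_positive_integer_dist a : ~ positive_integer a ->
  exists c, 0 < c /\ forall n, c * INR n.+1 <= Cmod (RtoC (INR n.+1) - a)%C.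
Proof.
move=> na.
have ne n : 0 < Cmod (RtoC (INR n.+1) - a)%C.
  apply/Cmod_gt_0 => E; apply: na; exists n.+1; split=> //.
  have -> : a = (RtoC (INR n.+1) - (RtoC (INR n.+1) - a))%C by ring.
  by rewrite E /Cminus Copp_0 Cplus_0_r.
have fin M : exists c, 0 < c /\ forall n, (n < M)%N -> c * INR n.+1 <= Cmod (RtoC (INR n.+1) - a)%C.
  elim: M => [|M [c [c0 Hc]]]; first by exists 1; split; [lra|].
  have M0 := INR_S_gt0 M.
  exists (Rmin c (Cmod (RtoC (INR M.+1) - a) / INR M.+1)); split.
    by apply: Rmin_glb_lt => //; apply: Rdiv_lt_0_compat.
  move=> n; rewrite ltnS leq_eqVlt => /orP[/eqP ->|nM].
    have H := Rmin_r c (Cmod (RtoC (INR M.+1) - a) / INR M.+1).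
    have := Rmult_le_compat_r (INR M.+1) _ _ (Rlt_le _ _ M0) H.
    by rewrite /Rdiv Rmult_assoc Rinv_l; lra.
  apply: Rle_trans (Hc n nM); apply: Rmult_le_compat_r (Rmin_l _ _).
  exact/Rlt_le/INR_S_gt0.
(* Beyond 2 |a| the constant 1 / 2 works; the finitely many smaller n each have a positive distance
   to a. *)
have [M HM] := INR_unbounded (2 * Cmod a).
have [c [c0 Hc]] := fin M; exists (Rmin c (/ 2)); split; first by apply: Rmin_glb_lt; lra.
move=> n; have n0 := INR_S_gt0 n.
have [nM|Mn] := ltnP n M.
  by apply: Rle_trans (Hc n nM); apply: Rmult_le_compat_r (Rmin_l _ _); lra.
apply: (Rle_trans _ (/ 2 * INR n.+1)); first by apply: Rmult_le_compat_r (Rmin_r _ _); lra.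
have := Cmod_triangle (RtoC (INR n.+1) - a)%C a.
have -> : (RtoC (INR n.+1) - a + a)%C = RtoC (INR n.+1) by ring.
rewrite Cmod_R Rabs_pos_eq; last lra.
have : INR M <= INR n.+1 by apply: le_INR; apply/leP; lia.
lra.
Qed.

Lemma pow_le_exp q d : 0 < d -> exists C, 0 <= C /\ forall t, 0 <= t -> t ^ q <= C * exp (d * t).
Proof.
move=> d0; case: q => [|q].
  exists 1; split; first lra; move=> t t0 /=.
  by have := exp_ineq1_le (d * t); nra.
have q0 := INR_S_gt0 q; pose e := INR q.+1 / d.
have e0 : 0 < e by apply: Rdiv_lt_0_compat.
exists (e ^ q.+1); split; first exact/Rlt_le/pow_lt.
move=> t t0.
have -> : exp (d * t) = exp (t / e) ^ q.+1.
  rewrite -[exp _ ^ _]exp_ln; last exact/pow_lt/exp_pos.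
  by rewrite ln_pow ?ln_exp; [congr exp; rewrite /e; field; lra|exact: exp_pos].
rewrite -Rpow_mult_distr; apply: pow_incr; split=> //.
have := exp_ineq1_le (t / e) => H.
have {1}-> : t = e * (t / e) by field; lra.
by apply: Rmult_le_compat_l; lra.
Qed.

Section Bounds.

Variables (b : bool) (a : C) (m : nat) (c : R).
Hypotheses (c_gt0 : 0 < c)
  (dist_a : forall n, c * INR n.+1 <= Cmod (RtoC (INR n.+1) - a)%C).

Lemma dist_a_neq0 n : (0 < n)%N -> (RtoC (INR n) - a)%C <> RtoC 0.
Proof.
case: n => // n _ E; have := dist_a n; rewrite E Cmod_0.
by have := INR_S_gt0 n; nra.
Qed.

Lemma Cmod_binv_le e j n :
  Cmod (binv e j (RtoC (INR n.+1) - a)) <= INR 'C(e + j - 1, j) / c ^ (e + j) / INR n.+1 ^ e.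
Proof.
have n0 := INR_S_gt0 n; have cp := pow_lt _ (e + j) c_gt0.
have np := pow_lt _ e n0; have np' := pow_lt _ (e + j) n0.
rewrite /binv Cmod_div; last by apply/Cpow_nz/dist_a_neq0.
rewrite Cmod_R Rabs_mult -RPow_abs Rabs_Ropp Rabs_R1 pow1 Rmult_1_l Cmod_pow.
have b0 := pos_INR 'C(e + j - 1, j); rewrite Rabs_pos_eq //.
rewrite {1}/Rdiv /Rdiv Rmult_assoc; apply: Rmult_le_compat_l => //.
rewrite -Rinv_mult; apply: Rinv_le_contravar; first exact: Rmult_lt_0_compat.
apply: (Rle_trans _ ((c * INR n.+1) ^ (e + j))).
  rewrite Rpow_mult_distr; apply: Rmult_le_compat_l; first lra.
  apply: Rle_pow; last by lia.
  by rewrite S_INR; have := pos_INR n; lra.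
apply: pow_incr; split=> //; nra.
Qed.

(** Higher coefficients in eps only bring further powers of 1 / (n - a), which are bounded, so the
    real coefficients dominate with a factor independent of n. *)
Lemma dcoef_le k : exists D : nat -> R, (forall p, 0 <= D p) /\
  forall p n, Cmod (dcoef b a k p n) <= D p * coef b k n.
Proof.
elim: k => [|e k [D [D0 HD]]].
  exists (fun=> 1); split; first by move=> p; lra.
  move=> p n; rewrite /dcoef /=; case: eqP => _ /=; last by rewrite Cmod_0; lra.
  by case: eqP => _; rewrite ?Cmod_1 ?Cmod_0; lra.
pose E p j := INR 'C(e + j - 1, j) / c ^ (e + j) * D (p - j)%N.
have E0 p j : 0 <= E p j.
  apply: Rmult_le_pos => //; apply: Rmult_le_pos; first exact: pos_INR.
  exact/Rlt_le/Rinv_0_lt_compat/pow_lt.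
exists (fun p => \rsum_(j < p.+1) E p j); split; first by move=> p; apply: rsum_ge0.
move=> p [|n]; first by rewrite dcoef_at0 coef_at0 Cmod_0; lra.
rewrite dcoef_cons coef_cons Cmod_mult Cmod_R Rabs_pos_eq; last exact: weight_at_ge0.
set S := \rsum_(i < _) coef b k i.
have -> : (\rsum_(j < p.+1) E p j) * (weight_at b (size k).+1 n.+1 / INR n.+1 ^ e * S) =
   weight_at b (size k).+1 n.+1 * ((\rsum_(j < p.+1) E p j) * (/ INR n.+1 ^ e * S)).
  by rewrite /Rdiv; ring.
apply: Rmult_le_compat_l; first exact: weight_at_ge0.
apply: Rle_trans (Cmod_sum _) _; rewrite big_distrl /=; apply: rsum_le => j.
rewrite Cmod_mult.
have -> : E p j * (/ INR n.+1 ^ e * S) =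
  INR 'C(e + j - 1, j) / c ^ (e + j) / INR n.+1 ^ e * (D (p - j)%N * S).
  by rewrite /E /Rdiv; ring.
apply: Rmult_le_compat; [exact: Cmod_ge_0|exact: Cmod_ge_0|exact: Cmod_binv_le|].
apply: Rle_trans (Cmod_sum _) _; rewrite big_distrr /=; apply: rsum_le => i.
exact: HD.
Qed.

(** After exchanging the sums, each i < N carries the gap weights times u^n over i < n < N; the full
    series would give u^i * u psi(u), and [gap_weight_tail] bounds the difference. *)
Lemma dsum_head0 N k y : y < 0 -> let u := exp y in
  Cmod (dsum b a m N (0%N :: k) y - RtoC (u * psi b u) * dsum b a m N k y) <=
  u ^ N * psi b u * \rsum_(i < N) \rsum_(p < m.+1)
    (Cmod (dcoef b a k p i) * Cmod (expmon (m - p) (- a) y)).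
Proof.
move=> y0 u.
have u01 : 0 < u < 1 by split; [exact: exp_pos|rewrite -exp_0; apply: exp_increasing].
pose T i := \rsum_(n < N) (if (i < n)%N then gap_weight b (n - i) * u ^ n else 0).
have -> : dsum b a m N (0%N :: k) y = \csum_(i < N) \csum_(p < m.+1)
    (dcoef b a k p i * expmon (m - p) (- a) y * RtoC (T i)).
  rewrite /dsum (eq_bigr (fun n : 'I_N => \csum_(i < N) \csum_(p < m.+1)
    (dcoef b a k p i * expmon (m - p) (- a) y *
     RtoC (if (i < n)%N then gap_weight b (n - i) * u ^ n else 0)%R))%C).
    rewrite exchange_big /=; apply: eq_bigr => i _.
    rewrite exchange_big /=; apply: eq_bigr => p _.
    rewrite -big_distrr /=; congr Cmult; rewrite /T.
    apply: (big_ind2 (fun z x => z = RtoC x)) => // z x w t -> ->.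
    by rewrite RtoC_plus.
  move=> n _; rewrite exchange_big /=; apply: eq_bigr => p _.
  rewrite dcoef_head0 expmon_shift -/u big_distrl /=.
  rewrite (big_ord_widen N (fun i => RtoC (gap_weight b (n - i)) * dcoef b a k p i *
    (RtoC (u ^ n)%R * expmon (m - p) (- a) y))%C); last exact/ltnW/ltn_ord.
  rewrite big_mkcond /=; apply: eq_bigr => i _.
  by case: ifP => _; rewrite ?RtoC_mult; ring.
have -> : dsum b a m N k y = \csum_(i < N) \csum_(p < m.+1)
    (dcoef b a k p i * expmon (m - p) (- a) y * RtoC (u ^ i)%R).
  apply: eq_bigr => i _; apply: eq_bigr => p _.
  by rewrite expmon_shift -/u; ring.
have -> : forall x z, (x - z)%C = (x + (RtoC (-1)) * z)%C by move=> x z; ring.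
rewrite !big_distrr /= -big_split /=.
apply: Rle_trans (Cmod_sum _) _; apply: rsum_le => i.
rewrite !big_distrr /= -big_split /=.
apply: Rle_trans (Cmod_sum _) _; apply: rsum_le => p.
have [t0 t1] := gap_weight_tail b u01 (ltn_ord i).
have -> : (dcoef b a k p i * expmon (m - p) (- a) y * RtoC (T i) +
   RtoC (-1) * (RtoC (u * psi b u) * (dcoef b a k p i * expmon (m - p) (- a) y * RtoC (u ^ i)%R)))%C
 = (RtoC (- (u ^ i * (u * psi b u) - T i)) * (dcoef b a k p i * expmon (m - p) (- a) y))%C.
  by rewrite RtoC_opp RtoC_minus !RtoC_mult; ring.
rewrite [Cmod (_ * (_ * _))]Cmod_mult Cmod_R Rabs_Ropp Rabs_pos_eq //.
rewrite (Cmod_mult (dcoef _ _ _ _ _)).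
by apply: Rmult_le_compat_r => //; apply: Rmult_le_pos; exact: Cmod_ge_0.
Qed.

End Bounds.

Section IntegralSteps.

Variables (b : bool) (a : C) (m : nat) (c : R).
Hypotheses (c_gt0 : 0 < c)
  (dist_a : forall n, c * INR n.+1 <= Cmod (RtoC (INR n.+1) - a)%C)
  (re_a : Re a < 1).

Let D := dsum b a m.

(** Here exp (- Re a y) is |u^(-a)|, and exp (- y) = 1 / u absorbs all powers of log u up to [m].
    Only the explicit sqrt N and u^N depend on N. *)
Lemma dsum_head0_le k : 0%N \notin k -> exists M, 0 <= M /\ forall N y, y < 0 ->
  let u := exp y in
  Cmod (D N (0%N :: k) y - RtoC (u * psi b u) * D N k y) <=
  M * sqrt (INR N) * (u ^ N * psi b u) * (exp (- Re a * y) * exp (- y)).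
Proof.
move=> /(coef_sum_le b)[B [B0 HB]].
have [E [E0 HE]] := @dcoef_le b a c c_gt0 dist_a k.
have ex q : exists M, 0 <= M /\ forall t, 0 <= t -> t ^ q <= M * exp t.
  have [M [M0 HM]] := @pow_le_exp q 1 Rlt_0_1; exists M; split=> // t t0.
  by have := HM t t0; rewrite Rmult_1_l.
have [M [M0 HM]] : exists M, 0 <= M /\ forall q t, (q <= m)%N -> 0 <= t -> t ^ q <= M * exp t.
  elim: m => [|n [M [M0 HM]]].
    have [M [M0 HM]] := ex 0%N; exists M; split=> // q t; rewrite leqn0 => /eqP ->.
    exact: HM.
  have [M' [M0' HM']] := ex n.+1; exists (M + M'); split; first lra.
  move=> q t; rewrite leq_eqVlt => /orP[/eqP ->|qn] t0.
    by have := HM' t t0; have := exp_pos t; nra.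
  by have := HM q t qn t0; have := exp_pos t; nra.
pose S := \rsum_(p < m.+1) E p.
have S0 : 0 <= S by apply: rsum_ge0.
exists (B * (S * M)); split; first by apply: Rmult_le_pos => //; apply: Rmult_le_pos.
move=> N y y0 u.
have u01 : 0 < u < 1 by split; [exact: exp_pos|rewrite -exp_0; apply: exp_increasing].
apply: Rle_trans (@dsum_head0 b a m N k y y0) _; rewrite -/u.
have up : 0 <= u ^ N * psi b u.
  by apply: Rmult_le_pos; [apply: pow_le; lra|apply: psi_ge0; lra].
set w := exp (- Re a * y) * exp (- y).
have w0 : 0 <= w by apply: Rmult_le_pos; apply/Rlt_le/exp_pos.
have -> : B * (S * M) * sqrt (INR N) * (u ^ N * psi b u) * w =
  u ^ N * psi b u * ((B * sqrt (INR N)) * (S * (M * w))) by ring.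
apply: Rmult_le_compat_l => //.
apply: (Rle_trans _ (\rsum_(i < N) (coef b k i * (S * (M * w))))).
  apply: rsum_le => i; rewrite /S big_distrl big_distrr /=; apply: rsum_le => p.
  apply: (Rle_trans _ (E p * coef b k i * (M * w))).
    apply: Rmult_le_compat; [exact: Cmod_ge_0|exact: Cmod_ge_0|exact: HE|].
    rewrite Cmod_expmon /w (Rmult_comm M) Rmult_assoc.
    rewrite (_ : Re (- a) = - Re a) //; apply: Rmult_le_compat_l; first exact/Rlt_le/exp_pos.
    rewrite Rabs_left //.
    have f1 : 1 <= INR (m - p)`!.
      by rewrite -[1]/(INR 1); apply: le_INR; apply/leP; rewrite fact_gt0.
    have H := HM (m - p)%N (- y) (leq_subr _ _) (Rlt_le _ _ (Ropp_0_gt_lt_contravar _ y0)).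
    have tp : 0 <= (- y) ^ (m - p) by apply: pow_le; lra.
    rewrite (Rmult_comm (exp _)); apply: Rle_trans H.
    rewrite -[X in _ <= X]Rmult_1_r; apply: Rmult_le_compat_l => //.
    by rewrite -Rinv_1; apply: Rinv_le_contravar; lra.
  by apply: Req_le; ring.
rewrite -big_distrl /=; apply: Rmult_le_compat_r.
  by apply: Rmult_le_pos => //; apply: Rmult_le_pos.
exact: HB.
Qed.

(** The n = 0 term vanishes, and for n >= 1 the hypothesis Re a < 1 makes n - Re a positive, so the
    exponential beats every power of y. The bound may depend on N: it serves boundary limits at
    fixed N. *)
Lemma dsum_bounded N e k r : exists M, 0 <= M /\ forall y, y < 0 ->
  (- y) ^ r * Cmod (D N (e :: k) y) <= M.
Proof.
pose bnd (f : R -> C) := exists M, 0 <= M /\ forall y, y < 0 -> (- y) ^ r * Cmod (f y) <= M.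
have sum n (f : 'I_n -> R -> C) : (forall i, bnd (f i)) -> bnd (fun y => \csum_(i < n) f i y).
  move=> Hf; elim: n f Hf => [|n IH] f Hf.
    by exists 0; split; [lra|move=> y _; rewrite big_ord0 Cmod_0; lra].
  have [M1 [M10 H1]] := Hf ord0; have [M2 [M20 H2]] := IH _ (fun i => Hf (lift ord0 i)).
  exists (M1 + M2); split; first lra; move=> y y0; rewrite big_ord_recl.
  have := H1 y y0; have := H2 y y0; have tp : 0 <= (- y) ^ r by apply: pow_le; lra.
  have := Rmult_le_compat_l _ _ _ tp (Cmod_triangle (f ord0 y) (\csum_(i < n) f (lift ord0 i) y)).
  lra.
apply: (sum) => -[n nN]; apply: (sum) => p /=.
case: n nN => [|n] _.
  exists 0; split; first lra; move=> y _; rewrite dcoef_at0 Cmult_0_l Cmod_0; lra.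
have d0 : 0 < INR n.+1 - Re a by rewrite S_INR; have := pos_INR n; lra.
have [M [M0 HM]] := @pow_le_exp (r + (m - p)) _ d0.
exists (Cmod (dcoef b a (e :: k) p n.+1) * M); split.
  by apply: Rmult_le_pos => //; exact: Cmod_ge_0.
move=> y y0; rewrite Cmod_mult (Rmult_comm (_ ^ _)) Rmult_assoc.
apply: Rmult_le_compat_l; first exact: Cmod_ge_0.
rewrite Cmod_expmon Rabs_left // (_ : Re _ = INR n.+1 - Re a) //.
have := HM (- y) _; rewrite pow_add => {}HM.
have e0 := exp_pos ((INR n.+1 - Re a) * y).
have -> : M = M * exp ((INR n.+1 - Re a) * - y) * exp ((INR n.+1 - Re a) * y).
  by rewrite Rmult_assoc -exp_plus -Rmult_plus_distr_l Rplus_opp_l Rmult_0_r exp_0 Rmult_1_r.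
have -> : exp ((INR n.+1 - Re a) * y) * ((- y) ^ (m - p) / INR (m - p)`!) * (- y) ^ r =
  ((- y) ^ r * (- y) ^ (m - p)) * / INR (m - p)`! * exp ((INR n.+1 - Re a) * y).
  by rewrite /Rdiv; ring.
apply: Rmult_le_compat_r; first lra.
apply: Rle_trans (HM _); last lra.
rewrite -[X in _ <= X]Rmult_1_r; apply: Rmult_le_compat_l.
  by rewrite -pow_add; apply: pow_le; lra.
rewrite -Rinv_1; apply: Rinv_le_contravar; first lra.
by rewrite -[1]/(INR 1); apply: le_INR; apply/leP; rewrite fact_gt0.
Qed.

(** At u = 1 every positive power of log u vanishes, so the boundary value is the eps^m coefficient
    of a truncated dual series. *)
Lemma dsum_at0 N k : D N k 0 = \csum_(n < N) dcoef b a k m n.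
Proof.
apply: eq_bigr => n _; rewrite big_ord_recr /= big1 => [|p _].
  by rewrite subnn expmon_at0 /= Cmult_1_r Cplus_0_l.
rewrite expmon_at0; case: eqP => [|_]; last by rewrite Cmult_0_r.
by have := ltn_ord p; lia.
Qed.

Lemma dsum_nil N y : D N.+1 [::] y = expmon m (- a) y.
Proof.
rewrite /D /dsum big_ord_recl [X in (_ + X)%C]big1 => [|n _]; last first.
  by rewrite big1 // => p _; rewrite /dcoef /= Cmult_0_l.
rewrite Cplus_0_r big_ord_recl [X in (_ + X)%C]big1 => [|p _]; last by rewrite /dcoef /= Cmult_0_l.
rewrite /dcoef /= Cplus_0_r Cmult_1_l subn0; congr expmon.
by rewrite /Cminus Cplus_0_l.
Qed.

End IntegralSteps.

(** * Endpoint limits and error estimates *)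

Lemma Cmod_le_Re_Im z : Cmod z <= Rabs (Re z) + Rabs (Im z).
Proof.
case: z => x y /=; have px := Rabs_pos x; have py := Rabs_pos y.
rewrite -(sqrt_Rsqr (Rabs x + Rabs y)); last lra.
apply: sqrt_le_1_alt; rewrite /= !Rmult_1_r.
have := Rsqr_abs x; have := Rsqr_abs y; rewrite /Rsqr => -> ->; nra.
Qed.

Lemma im_le_Cmod z : Rabs (Im z) <= Cmod z.
Proof. exact: Rle_trans (Rmax_r _ _) (Rmax_Cmod z). Qed.

Definition lim_ends (f : R -> C) (l0 l1 : C) : Prop :=
  (forall eps, 0 < eps -> exists d, 0 < d /\
     forall x, 0 < x < 1 -> x < d -> Cmod (f x - l0) < eps) /\
  (forall eps, 0 < eps -> exists d, 0 < d /\
     forall x, 0 < x < 1 -> 1 - d < x -> Cmod (f x - l1) < eps).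

Lemma lim_ends_plus f g k0 k1 l0 l1 : lim_ends f k0 k1 -> lim_ends g l0 l1 ->
  lim_ends (fun x => f x + g x)%C (k0 + l0)%C (k1 + l1)%C.
Proof.
have tri z k w l : Cmod (z + w - (k + l))%C <= Cmod (z - k) + Cmod (w - l).
  have -> : (z + w - (k + l))%C = ((z - k) + (w - l))%C by ring.
  exact: Cmod_triangle.
move=> [f0 f1] [g0 g1]; split=> eps e0; have e2 : 0 < eps / 2 by lra.
  have [d [d0 Hd]] := f0 _ e2; have [d' [d0' Hd']] := g0 _ e2.
  exists (Rmin d d'); split; first exact: Rmin_glb_lt.
  move=> x x01 xd; have := Hd x x01; have := Hd' x x01.
  have := Rmin_l d d'; have := Rmin_r d d'; have := tri (f x) k0 (g x) l0; lra.
have [d [d0 Hd]] := f1 _ e2; have [d' [d0' Hd']] := g1 _ e2.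
exists (Rmin d d'); split; first exact: Rmin_glb_lt.
move=> x x01 xd; have := Hd x x01; have := Hd' x x01.
have := Rmin_l d d'; have := Rmin_r d d'; have := tri (f x) k1 (g x) l1; lra.
Qed.

Lemma Cderive_cont f y l eps : Cderive f y l -> 0 < eps ->
  exists d, 0 < d /\ forall z, Rabs (z - y) < d -> Cmod (f z - f y) < eps.
Proof.
move=> [dr di] e0; have e2 : 0 < eps / 2 by lra.
have cr : continuous (fun x => Re (f x)) y by apply: ex_derive_continuous; exists (Re l).
have ci : continuous (fun x => Im (f x)) y by apply: ex_derive_continuous; exists (Im l).
have [d Hd] := cr _ (locally_ball _ (mkposreal _ e2)).
have [d' Hd'] := ci _ (locally_ball _ (mkposreal _ e2)).
exists (Rmin d d'); split; first by apply: Rmin_glb_lt; apply: cond_pos.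
move=> z zd; apply: Rle_lt_trans (Cmod_le_Re_Im _) _.
have H1 : Rabs (Re (f z) - Re (f y)) < eps / 2.
  by apply: (Hd z); apply: Rlt_le_trans zd (Rmin_l _ _).
have H2 : Rabs (Im (f z) - Im (f y)) < eps / 2.
  by apply: (Hd' z); apply: Rlt_le_trans zd (Rmin_r _ _).
rewrite (_ : Re (f z - f y) = Re (f z) - Re (f y)) //.
rewrite (_ : Im (f z - f y) = Im (f z) - Im (f y)) //; lra.
Qed.

Section Ends.

Variable b : bool.

Lemma ell_near0 x : 0 < x < / 2 -> ell b x <= 6 * x.
Proof.
move=> x0; have x01 : 0 < x < 1 by lra.
have := ell_le b x01; have [[s0 s1] _] := swap_bounds b x01.
have s3 : / 3 <= swap b x.
  rewrite /swap; case: b; last lra.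
  apply: (Rmult_le_reg_r (1 + x)); first lra.
  have -> : (1 - x) / (1 + x) * (1 + x) = 1 - x by field; lra.
  lra.
move=> H; have -> : ell b x = ell b x / x * x by field; lra.
apply: Rmult_le_compat_r; first lra.
apply: Rle_trans H _; have := Rinv_le_contravar _ _ _ s3; lra.
Qed.

Lemma ell_near1 A : 0 < A -> exists d, 0 < d /\ forall x, 0 < x < 1 -> 1 - d < x -> A < ell b x.
Proof.
move=> A0; exists (exp (- A)); split; first exact: exp_pos.
move=> x x01 xd; have [[s0 s1] s2] := swap_bounds b x01.
have : ln (swap b x) < ln (exp (- A)) by apply: ln_increasing => //; lra.
by rewrite ln_exp /ell; lra.
Qed.

(** Since ell tends to 0 at 0 and to infinity at 1, bounds by M ell and by M / ell settle the two
    ends. *)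
Lemma lim_ends_ell f M : 
  (forall x, 0 < x < 1 -> Cmod (f x) <= M * ell b x /\ Cmod (f x) * ell b x <= M) ->
  lim_ends f (RtoC 0) (RtoC 0).
Proof.
move=> H; have M0 : 0 <= M.
  have x01 : 0 < / 2 < 1 by lra.
  have [_] := H _ x01; apply: Rle_trans.
  by apply: Rmult_le_pos; [exact: Cmod_ge_0|exact/Rlt_le/ell_gt0].
split=> eps e0.
  exists (Rmin (/ 2) (eps / (6 * (M + 1)))); split.
    by apply: Rmin_glb_lt; [lra|apply: Rdiv_lt_0_compat; lra].
  move=> x x01 xd; have [] := H x x01; rewrite /Cminus Copp_0 Cplus_0_r => H1 _.
  have x2 := Rlt_le_trans _ _ _ xd (Rmin_l _ _).
  have xe := Rlt_le_trans _ _ _ xd (Rmin_r _ _).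
  have l6 : ell b x <= 6 * x by apply: ell_near0; lra.
  apply: Rle_lt_trans H1 _.
  apply: Rle_lt_trans (Rmult_le_compat_l _ _ _ M0 l6) _.
  have := Rmult_lt_compat_r (6 * (M + 1)) _ _ _ xe.
  have -> : eps / (6 * (M + 1)) * (6 * (M + 1)) = eps by field; lra.
  move=> H2; have := H2 _; nra.
have A0 : 0 < M / eps + 1.
  have : 0 <= M / eps by apply: Rmult_le_pos => //; exact/Rlt_le/Rinv_0_lt_compat.
  lra.
have [d [d0 Hd]] := ell_near1 A0.
exists d; split=> // x x01 xd; have [_] := H x x01; rewrite /Cminus Copp_0 Cplus_0_r => H1.
have l0 := ell_gt0 b x01; have := Hd x x01 xd => H2.
apply: (Rmult_lt_reg_r (ell b x)) => //; apply: Rle_lt_trans H1 _.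
have := Rmult_lt_compat_l _ _ _ e0 H2.
have -> : eps * (M / eps + 1) = M + eps by field; lra.
lra.
Qed.

End Ends.

Lemma sqrt_over_le (M : R) (N0 : nat) eps : 0 <= M -> 0 < eps -> exists N1, 
  forall N, (N1 <= N)%N -> M * sqrt (INR N) / INR (N - N0).+1 < eps.
Proof.
move=> M0 e0; have [P HP] := INR_unbounded ((2 * M / eps) * (2 * M / eps)).
(* The summand 2 N0 gives N <= 2 (N - N0 + 1), and P makes sqrt N exceed 2 M / eps. *)
exists (P + 2 * N0)%N => N NP.
have PN : INR P <= INR N by apply: le_INR; apply/leP; lia.
set s := sqrt (INR N); have s0 : 0 <= s by apply: sqrt_pos.
have N0' := pos_INR N; have ss : s * s = INR N by apply: sqrt_sqrt.
have me : 0 <= 2 * M / eps by apply: Rmult_le_pos; [lra|exact/Rlt_le/Rinv_0_lt_compat].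
have s1 : 2 * M / eps < s by nra.
have N2 : INR N <= 2 * INR (N - N0).+1.
  by rewrite -[2]/(INR 2) -mult_INR; apply: le_INR; apply/leP; rewrite multE; lia.
have n0 := INR_S_gt0 (N - N0).
apply: (Rmult_lt_reg_r (INR (N - N0).+1)) => //.
have -> : M * s / INR (N - N0).+1 * INR (N - N0).+1 = M * s by field; lra.
have : 2 * M < s * eps.
  have := Rmult_lt_compat_r _ _ _ e0 s1.
  have -> : 2 * M / eps * eps = 2 * M by field; lra.
  by [].
nra.
Qed.

(** Integrability of [err] is not assumed. The integral of [f] plus [phi] has derivative [err], so
    it becomes monotone after adding or subtracting a primitive of B (1 - x)^q. *)
Lemma RInt_approx (f phi err : R -> R) (B : R) (q : nat) b0 b1 :
  0 < b0 -> b0 <= b1 -> b1 < 1 -> 0 <= B ->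
  (forall x, 0 < x < 1 -> continuous f x) ->
  (forall x, 0 < x < 1 -> is_derive phi x (err x - f x)) ->
  (forall x, 0 < x < 1 -> Rabs (err x) <= B * (1 - x) ^ q) ->
  Rabs (RInt f b0 b1 - (phi b0 - phi b1)) <= B / INR q.+1.
Proof.
move=> b00 b01 b11 B0 fc dphi ebd; have q0 := INR_S_gt0 q.
have fint x y : 0 < x < 1 -> 0 < y < 1 -> ex_RInt f x y.
  move=> x01 y01; apply: ex_RInt_continuous => z z01; apply: fc.
  by move: z01; rewrite /Rmin /Rmax; case: Rle_dec; lra.
pose g x := RInt f b0 x + phi x.
have dg x : 0 < x < 1 -> is_derive g x (err x).
  move=> x01; apply: (is_derive_eq (k := f x + (err x - f x))); last by ring.
  apply: is_derive_plus; last exact: dphi.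
  apply: (is_derive_RInt f); last exact: fc.
  exists (mkposreal (Rmin x (1 - x)) (Rmin_glb_lt _ _ _ (proj1 x01) (Rlt_Rminus _ _ (proj2 x01)))).
  move=> y /=; rewrite /ball /= /AbsRing_ball /= /abs /minus /plus /opp /= => yx.
  apply: RInt_correct; apply: fint; first lra.
  have := Rlt_le_trans _ _ _ yx (Rmin_l _ _); have := Rlt_le_trans _ _ _ yx (Rmin_r _ _).
  by rewrite /Rabs; case: Rcase_abs; lra.
pose P x := - (B / INR q.+1 * (1 - x) ^ q.+1).
have dP x : is_derive P x (B * (1 - x) ^ q).
  rewrite /P; auto_derive => //.
  by rewrite -/(INR q.+1) /Rminus; field; lra.
have mono (h dh : R -> R) : (forall x, 0 < x < 1 -> is_derive h x (dh x)) ->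
   (forall x, 0 < x < 1 -> 0 <= dh x) -> h b0 <= h b1.
  move=> H1 H2; have [||z [z01 E]] := MVT_gen h b0 b1 dh.
  - by rewrite Rmin_left ?Rmax_right //; move=> x x01; apply: H1; lra.
  - rewrite Rmin_left ?Rmax_right //; move=> x x01.
    apply/continuity_pt_filterlim/ex_derive_continuous; exists (dh x); apply: H1; lra.
  move: z01; rewrite Rmin_left ?Rmax_right // => z01.
  have := H2 z; nra.
have g0 : g b0 = phi b0 by rewrite /g RInt_point /zero /= Rplus_0_l.
have m1 : g b0 + P b0 <= g b1 + P b1.
  apply: (mono (fun x => g x + P x) (fun x => err x + B * (1 - x) ^ q)) => x x01.
    by apply: is_derive_plus; [exact: dg|exact: dP].
  by have := ebd x x01; rewrite /Rabs; case: Rcase_abs; lra.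
have m2 : P b0 - g b0 <= P b1 - g b1.
  apply: (mono (fun x => P x - g x) (fun x => B * (1 - x) ^ q - err x)) => x x01.
    by apply: is_derive_minus; [exact: dP|exact: dg].
  by have := ebd x x01; rewrite /Rabs; case: Rcase_abs; lra.
have Bq : 0 <= B / INR q.+1 by apply: Rmult_le_pos => //; exact/Rlt_le/Rinv_0_lt_compat.
have p1 : P b1 <= 0.
  by rewrite /P; have := pow_le (1 - b1) q.+1 ltac:(lra); nra.
have p0 : - (B / INR q.+1) <= P b0.
  rewrite /P; have : (1 - b0) ^ q.+1 <= 1.
    by rewrite -[X in _ <= X](pow1 q.+1); apply: pow_incr; lra.
  by move: Bq; set z := B / _; nra.
by move: m1 m2; rewrite g0 /g => m1 m2; apply: Rabs_le; lra.
Qed.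

Arguments coef : simpl never.

(** * Integration by parts along the word *)

(* Up to an error that becomes negligible as N grows, the integral of F N over
   ]0, 1[ is that of G N plus S N. *)
Definition reduces (F G : nat -> R -> C) (S : nat -> C) : Prop :=
  exists M N0, 0 <= M /\ forall N, (N0 <= N)%N -> exists phi err : R -> C,
    [/\ forall x, 0 < x < 1 -> Cderive phi x (err x + G N x - F N x)%C,
        forall x, 0 < x < 1 -> Cmod (err x) <= M * sqrt (INR N) * (1 - x) ^ (N - N0)
      & lim_ends phi (S N) (RtoC 0)].

Lemma reduces_trans F G H S T : reduces F G S -> reduces G H T ->
  reduces F H (fun N => S N + T N)%C.
Proof.
move=> [M [N0 [M0 HM]]] [M' [N0' [M0' HM']]].
exists (M + M'), (N0 + N0')%N; split; first lra; move=> N NN.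
have [phi [err [d1 d2 d3]]] := HM N ltac:(lia).
have [phi' [err' [d1' d2' d3']]] := HM' N ltac:(lia).
exists (fun x => phi x + phi' x)%C, (fun x => err x + err' x)%C; split.
- move=> x x01; apply: Cderive_eq (Cderive_plus (d1 x x01) (d1' x x01)) _; ring.
- move=> x x01; apply: Rle_trans (Cmod_triangle _ _) _.
  have := d2 x x01; have := d2' x x01; have s0 := sqrt_pos (INR N).
  have le i j : (j <= i)%N -> (1 - x) ^ i <= (1 - x) ^ j.
    move=> ji; rewrite -(subnK ji) pow_add -[X in _ <= X]Rmult_1_l.
    apply: Rmult_le_compat_r; first by apply: pow_le; lra.
    by rewrite -[X in _ <= X](pow1 (i - j)); apply: pow_incr; lra.
  have l1 : M * sqrt (INR N) * (1 - x) ^ (N - N0) <= M * sqrt (INR N) * (1 - x) ^ (N - (N0 + N0')).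
    by apply: Rmult_le_compat_l; [apply: Rmult_le_pos|apply: le; lia].
  have l2 : M' * sqrt (INR N) * (1 - x) ^ (N - N0') <= M' * sqrt (INR N) * (1 - x) ^ (N - (N0 + N0')).
    by apply: Rmult_le_compat_l; [apply: Rmult_le_pos|apply: le; lia].
  lra.
- by have := lim_ends_plus d3 d3'; rewrite Cplus_0_l.
Qed.

Section Steps.

Variables (b : bool) (a : C) (m : nat) (c : R).
Hypotheses (c_gt0 : 0 < c)
  (dist_a : forall n, c * INR n.+1 <= Cmod (RtoC (INR n.+1) - a)%C)
  (re_a : Re a < 1).

Let D := dsum b a m.

(** An intermediate state: [k] is the part of the word still to be read, [K] the dual index built so
    far. A leading 0 in [k] means that the next letter is psi dx. *)
Definition step_integrand (k K : seq nat) (N : nat) (x : R) : C :=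
  (RtoC (L b k x / x) * dsum b a m N K (- ell b x))%C.

Lemma Cderive_dsum_ell N e K x : 0 < x < 1 ->
  Cderive (fun x => D N (e.+1 :: K) (- ell b x)) x
    (RtoC (- psi b x) * D N (e :: K) (- ell b x))%C.
Proof.
move=> x01; apply: (@Cderive_comp (D N (e.+1 :: K)) (fun x => - ell b x)).
  by apply: Cderive_dsum => n n0; apply: (dist_a_neq0 c_gt0 dist_a).
by apply: is_derive_opp; apply: is_derive_ell; lra.
Qed.

Lemma exp_ell x : 0 < x < 1 -> exp (- ell b x) = swap b x.
Proof. by move=> /(swap_bounds b)[[s0 _] _]; rewrite /ell Ropp_involutive exp_ln. Qed.

(** The polylogarithm is at most ell^(r+1); against it the powers r and r + 2 in [dsum_bounded]
    leave ell and 1 / ell. *)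
Lemma lim_ends_L_dsum (k : seq nat) e K N : 0%N \notin k -> k != [::] ->
  lim_ends (fun x => RtoC (L b k x) * D N (e :: K) (- ell b x))%C (RtoC 0) (RtoC 0).
Proof.
move=> k0 kn; have [r kr] : exists r, size k = r.+1 by case: k kn {k0} => // f k; exists (size k).
have [M1 [M10 H1]] := @dsum_bounded b a m re_a N e K r.
have [M2 [M20 H2]] := @dsum_bounded b a m re_a N e K r.+2.
apply: (@lim_ends_ell b _ (M1 + M2)) => x x01.
have l0 := ell_gt0 b x01.
have := H1 (- ell b x) ltac:(lra); have := H2 (- ell b x) ltac:(lra).
rewrite Ropp_involutive -/D; set d := Cmod (D _ _ _) => h2 h1.
have d0 : 0 <= d by apply: Cmod_ge_0.
have Lx : 0 <= L b k x by apply: L_ge0 => //; lra.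
have Le : L b k x <= ell b x ^ r.+1 by rewrite -kr; apply: L_le_ell => //; lra.
rewrite Cmod_mult Cmod_R Rabs_pos_eq // -/d.
have Ld : L b k x * d <= ell b x ^ r.+1 * d by apply: Rmult_le_compat_r.
split.
  apply: Rle_trans Ld _; have -> : ell b x ^ r.+1 * d = (ell b x ^ r * d) * ell b x by rewrite /=; ring.
  by apply: Rmult_le_compat_r; lra.
apply: Rle_trans (Rmult_le_compat_r _ _ _ (Rlt_le _ _ l0) Ld) _.
have -> : ell b x ^ r.+1 * d * ell b x = ell b x ^ r.+2 * d by rewrite /=; ring.
lra.
Qed.

(** In the derivative of L (e.+1 :: k) D (1 :: K), the second term contains D (0 :: K), which is u
    psi(u) D K up to the truncation error; [psi_swap] then turns psi(x) u psi(u) into 1 / x. *)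
Lemma reduces_x e (k K : seq nat) : 0%N \notin k -> 0%N \notin K ->
  reduces (step_integrand (e.+1 :: k) K) (step_integrand (e :: k) (1%N :: K)) (fun=> RtoC 0).
Proof.
move=> k0 K0; have [M [M0 HM]] := @dsum_head0_le b a m c c_gt0 dist_a K K0.
have [Q [Q0 HQ]] := @pow_le_exp (size k) 1 Rlt_0_1.
(* Besides |u^(-a)|, four powers of 1 / u are spent: on ell / x, on ell^r with r the size of [k], on
   splitting off the u of u psi(u), and on the logarithms in [dsum_head0_le]. *)
have [N0 HN0] := INR_unbounded (Re a + 4).
exists (2 * Q * M), N0; split; first nra; move=> N NN0.
pose rem x := (D N (0%N :: K) (- ell b x) -
   RtoC (swap b x * psi b (swap b x)) * D N K (- ell b x))%C.
exists (fun x => RtoC (L b (e.+1 :: k) x) * D N (1%N :: K) (- ell b x))%C.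
exists (fun x => - (RtoC (L b (e.+1 :: k) x * psi b x) * rem x))%C.
have k0' : 0%N \notin e.+1 :: k by rewrite inE.
split; last by apply: lim_ends_L_dsum.
  move=> x x01; apply: Cderive_eq.
    apply: Cderive_mult; last exact: Cderive_dsum_ell.
    by apply: Cderive_RtoC; apply: is_derive_L.
  rewrite /step_integrand /rem -/D.
  have -> : L b (e.+1 :: k) x / x =
     L b (e.+1 :: k) x * (psi b x * (swap b x * psi b (swap b x))).
    by rewrite psi_swap.
  rewrite RtoC_opp !RtoC_mult; ring.
move=> x x01; have l0 := ell_gt0 b x01.
have [[s0 s1] s2] := swap_bounds b x01.
have p0 : 0 <= psi b x by apply: psi_ge0; lra.
have Lx : 0 <= L b (e.+1 :: k) x by apply: L_ge0 => //; lra.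
have Le : L b (e.+1 :: k) x <= ell b x * ell b x ^ size k := @L_le_ell b _ x k0' ltac:(lra).
have := HM N (- ell b x) ltac:(lra); rewrite exp_ell // -/(rem x) Ropp_involutive => Hr.
rewrite Cmod_opp Cmod_mult Cmod_R Rabs_pos_eq; last exact: Rmult_le_pos.
apply: Rle_trans (Rmult_le_compat_l _ _ _ (Rmult_le_pos _ _ Lx p0) Hr) _.
have E : exp (ell b x) = / swap b x by rewrite -exp_ell // exp_Ropp Rinv_inv.
have -> : L b (e.+1 :: k) x * psi b x * (M * sqrt (INR N) * (swap b x ^ N * psi b (swap b x)) *
   (exp (- Re a * - ell b x) * exp (ell b x))) =
  M * sqrt (INR N) * (L b (e.+1 :: k) x * (psi b x * (swap b x * psi b (swap b x)))) *
   (swap b x ^ N * / swap b x * exp (- Re a * - ell b x) * exp (ell b x)).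
  by field; lra.
rewrite psi_swap // -E.
have s0' := sqrt_pos (INR N).
have -> : 2 * Q * M * sqrt (INR N) * (1 - x) ^ (N - N0) =
  M * sqrt (INR N) * (2 * Q * (1 - x) ^ (N - N0)) by ring.
rewrite Rmult_assoc; apply: Rmult_le_compat_l; first exact: Rmult_le_pos.
have e0 := exp_pos (ell b x); have e1 := exp_pos (- Re a * - ell b x).
have sN := pow_lt _ N s0.
have Lxx : L b (e.+1 :: k) x * / x <= 2 * Q * (exp (ell b x) * exp (ell b x)).
  have q1 := HQ (ell b x) (Rlt_le _ _ l0); rewrite Rmult_1_l in q1.
  have q0 := pow_le _ (size k) (Rlt_le _ _ l0).
  have := ell_le b x01; rewrite /Rdiv -E => q2.
  apply: (Rle_trans _ ((ell b x * / x) * ell b x ^ size k)).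
    have -> : ell b x * / x * ell b x ^ size k = ell b x * ell b x ^ size k * / x by ring.
    by apply: Rmult_le_compat_r => //; apply/Rlt_le/Rinv_0_lt_compat; lra.
  have -> : 2 * Q * (exp (ell b x) * exp (ell b x)) = 2 * exp (ell b x) * (Q * exp (ell b x)) by ring.
  apply: Rmult_le_compat => //; apply: Rmult_le_pos; first lra.
  by apply/Rlt_le/Rinv_0_lt_compat; lra.
apply: (Rle_trans _ (2 * Q * (exp (ell b x) * exp (ell b x)) *
   (swap b x ^ N * exp (ell b x) * exp (- Re a * - ell b x) * exp (ell b x)))).
  by apply: Rmult_le_compat_r => //; do ?[apply: Rmult_le_pos => //]; lra.
rewrite Rmult_assoc; apply: Rmult_le_compat_l; first lra.
have pw i : swap b x ^ i = exp (- (INR i * ell b x)).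
  rewrite -exp_ell //; elim: i => [|i IH]; first by rewrite /= Rmult_0_l Ropp_0 exp_0.
  by rewrite -tech_pow_Rmult IH -exp_plus S_INR; congr exp; ring.
apply: (Rle_trans _ (swap b x ^ (N - N0))); last by apply: pow_incr; lra.
rewrite !pw -!exp_plus minus_INR; last by apply/leP.
have -> : ell b x + ell b x +
  (- (INR N * ell b x) + ell b x + - Re a * - ell b x + ell b x) =
  - ((INR N - (Re a + 4)) * ell b x) by ring.
have : - ((INR N - (Re a + 4)) * ell b x) <= - ((INR N - INR N0) * ell b x) by nra.
by case=> [/exp_increasing|->]; lra.
Qed.

(** This letter is exact, because the derivative of the cofactor and [L_head0] produce the same
    psi(x); the truncated series enters only at the letter dx / x. *)
Lemma reduces_y e (k : seq nat) f K : 0%N \notin k ->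
  reduces (step_integrand [:: 0%N, e.+1 & k] (f :: K))
    (step_integrand (e :: k) (f.+1 :: K)) (fun=> RtoC 0).
Proof.
move=> k0; exists 0, 0%N; split; first lra; move=> N _.
have k0' : 0%N \notin e.+1 :: k by rewrite inE.
exists (fun x => RtoC (L b (e.+1 :: k) x) * D N (f.+1 :: K) (- ell b x))%C, (fun=> RtoC 0).
split; last by apply: lim_ends_L_dsum.
  move=> x x01; apply: Cderive_eq.
    apply: Cderive_mult; last exact: Cderive_dsum_ell.
    by apply: Cderive_RtoC; apply: is_derive_L.
  rewrite /step_integrand -/D L_head0 // ?Rabs_pos_eq; try lra.
  have -> : x * psi b x * L b (e.+1 :: k) x / x = psi b x * L b (e.+1 :: k) x by field; lra.
  rewrite RtoC_opp !RtoC_mult; ring.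
by move=> x x01; rewrite Cmod_0 !Rmult_0_l; lra.
Qed.

(** Once the word is used up, no polylogarithm forces the boundary term at x = 0 to vanish, and the
    truncated dual series appears there. *)
Lemma reduces_last f K :
  reduces (step_integrand [:: 0%N] (f :: K)) (fun _ _ => RtoC 0)
    (fun N => \csum_(n < N) dcoef b a (f.+1 :: K) m n).
Proof.
exists 0, 0%N; split; first lra; move=> N _.
exists (fun x => D N (f.+1 :: K) (- ell b x)), (fun=> RtoC 0); split.
- move=> x x01; apply: Cderive_eq; first exact: Cderive_dsum_ell.
  rewrite /step_integrand -/D L_head0 // ?Rabs_pos_eq ?L_nil ?Rabs_pos_eq; try lra.
  have -> : x * psi b x * 1 / x = psi b x by field; lra.
  by rewrite RtoC_opp; ring.
- by move=> x x01; rewrite Cmod_0 !Rmult_0_l; lra.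
split=> eps e0.
  have dd : Cderive (D N (f.+1 :: K)) 0 (D N (f :: K) 0).
    by apply: Cderive_dsum => n n0; apply: (dist_a_neq0 c_gt0 dist_a).
  have [d [d0 Hd]] := Cderive_cont dd e0.
  exists (Rmin (/ 2) (d / 6)); split; first by apply: Rmin_glb_lt; lra.
  move=> x x01 xd; rewrite -(dsum_at0 b a m).
  have x2 := Rlt_le_trans _ _ _ xd (Rmin_l _ _).
  have x6 := Rlt_le_trans _ _ _ xd (Rmin_r _ _).
  apply: Hd; have := @ell_near0 b x ltac:(lra); have := ell_gt0 b x01.
  by rewrite Rminus_0_r Rabs_Ropp => ? ?; rewrite Rabs_pos_eq; lra.
have [M [M0 HM]] := @dsum_bounded b a m re_a N f.+1 K 1.
have A0 : 0 < M / eps + 1.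
  have : 0 <= M / eps by apply: Rmult_le_pos => //; exact/Rlt_le/Rinv_0_lt_compat.
  lra.
have [d [d0 Hd]] := ell_near1 b A0.
exists d; split=> // x x01 xd; rewrite /Cminus Copp_0 Cplus_0_r.
have l0 := ell_gt0 b x01; have H2 := Hd x x01 xd.
have := HM (- ell b x) ltac:(lra); rewrite Ropp_involutive pow_1 => H1.
apply: (Rmult_lt_reg_l (ell b x)) => //; apply: Rle_lt_trans H1 _.
have := Rmult_lt_compat_l _ _ _ e0 H2.
have -> : eps * (M / eps + 1) = M + eps by field; lra.
lra.
Qed.

(** The leading entry [e] stands for [e] letters dx / x, the 1 / x of the integrand being one of
    them; a later entry f contributes f - 1. The last condition excludes a letter psi dx before any
    dx / x, when the dual has no leading entry to increment. *)
Lemma reduces_word e (k K : seq nat) : 0%N \notin k -> 0%N \notin K -> (0 < e)%N || (K != [::]) ->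
  reduces (step_integrand (e :: k) K) (fun _ _ => RtoC 0)
    (fun N => \csum_(n < N)
       dcoef b a (dual_word (plus_head (ncons e 1%N K)) k) m n).
Proof.
have ext F G S T : (forall N, S N = T N) -> reduces F G S -> reduces F G T.
  move=> ST [M [N0 [M0 HM]]]; exists M, N0; split=> // N /HM[phi [err [h1 h2 h3]]].
  by exists phi, err; rewrite -ST.
have ones e' K' : ncons e' 1%N (1%N :: K') = ncons e'.+1 1%N K' by elim: e' => //= e' ->.
elim: k e K => [|f k IHk]; elim=> [|e IHe] K.
- by case: K => [//|f K] _ _ _; apply: reduces_last.
- move=> k0 K0 _; apply: ext (reduces_trans (reduces_x e k0 K0) (IHe _ k0 _ _)) => //.
  - by move=> N; rewrite Cplus_0_l ones.
  - by rewrite orbT.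
- case: K => [//|g K]; rewrite inE negb_or eq_sym -lt0n; case: f => [|f] /andP[] // _ k0 K0 _.
  apply: ext (reduces_trans (reduces_y f g K k0) (IHk _ _ k0 _ _)) => //.
  - by move=> N; rewrite Cplus_0_l.
  - by move: K0; rewrite !inE !negb_or => /andP[_ ->].
  - by rewrite orbT.
- move=> k0 K0 _; apply: ext (reduces_trans (reduces_x e k0 K0) (IHe _ k0 _ _)) => //.
  - by move=> N; rewrite Cplus_0_l ones.
  - by rewrite orbT.
Qed.

End Steps.

Definition Ccvg (S : nat -> C) (l : C) : Prop :=
  forall eps, 0 < eps -> exists N0, forall N, (N0 <= N)%N -> Cmod (S N - l) < eps.

(** N is chosen from eps alone, and only then the neighbourhoods of the endpoints. As [f] agrees
    with F N for every N > 0, each N estimates the same integral, whose convergence is thereby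
    proved and not presupposed. *)
Lemma reduces_is_RInt_gen f F S l :
  reduces F (fun _ _ => RtoC 0) S -> Ccvg S l ->
  (forall N x, (0 < N)%N -> 0 < x < 1 -> f x = F N x) ->
  (forall x, 0 < x < 1 -> continuous (fun x => Re (f x)) x) ->
  (forall x, 0 < x < 1 -> continuous (fun x => Im (f x)) x) ->
  is_RInt_gen (V := C_R_NormedModule) f (at_right 0) (at_left 1) l.
Proof.
move=> [M [N0 [M0 HM]]] Sl fF cr ci P [eps HP].
have e0 := cond_pos eps; pose e4 := eps / 8; have e40 : 0 < e4 by rewrite /e4; lra.
have [N1 H1] := Sl _ e40; have [N2 H2] := sqrt_over_le N0 M0 e40.
pose N := (N0 + N1 + N2 + 1)%N.
have {}H1 := H1 N ltac:(lia); have {}H2 := H2 N ltac:(lia).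
have [phi [err [dphi ebd [l0 l1]]]] := HM N ltac:(lia).
have {l0}[d0 [d00 l0]] := l0 _ e40; have {l1}[d1 [d10 l1]] := l1 _ e40.
have Bp : 0 <= M * sqrt (INR N) by apply: Rmult_le_pos => //; apply: sqrt_pos.
have main b0 b1 : 0 < b0 < / 2 -> b0 < d0 -> / 2 < b1 < 1 -> 1 - d1 < b1 ->
    is_RInt (V := C_R_NormedModule) f b0 b1
      (RInt (fun x => Re (f x)) b0 b1, RInt (fun x => Im (f x)) b0 b1) /\
    P (RInt (fun x => Re (f x)) b0 b1, RInt (fun x => Im (f x)) b0 b1).
  move=> b00 bd0 b10 bd1.
  have exi (g : R -> R) : (forall x, 0 < x < 1 -> continuous g x) -> is_RInt g b0 b1 (RInt g b0 b1).
    move=> cg; apply: RInt_correct; apply: ex_RInt_continuous => z.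
    by rewrite Rmin_left ?Rmax_right; try lra; move=> z01; apply: cg; lra.
  split.
    by apply: (is_RInt_fct_extend_pair (U := R_NormedModule) (V := R_NormedModule)); apply: exi.
  have Ef x : 0 < x < 1 -> f x = F N x by apply: fF; rewrite /N addn1.
  have hr : Rabs (RInt (fun x => Re (f x)) b0 b1 - (Re (phi b0) - Re (phi b1))) <=
      M * sqrt (INR N) / INR (N - N0).+1.
    apply: (@RInt_approx (fun x => Re (f x)) (fun x => Re (phi x)) (fun x => Re (err x))) => //; try lra.
      move=> x x01; apply: is_derive_eq (proj1 (dphi x x01)) _.
      by rewrite -Ef // /Re /=; ring.
    by move=> x x01; apply: Rle_trans (re_le_Cmod _) _; apply: ebd.
  have hi : Rabs (RInt (fun x => Im (f x)) b0 b1 - (Im (phi b0) - Im (phi b1))) <=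
      M * sqrt (INR N) / INR (N - N0).+1.
    apply: (@RInt_approx (fun x => Im (f x)) (fun x => Im (phi x)) (fun x => Im (err x))) => //; try lra.
      move=> x x01; apply: is_derive_eq (proj2 (dphi x x01)) _.
      by rewrite -Ef // /Im /=; ring.
    by move=> x x01; apply: Rle_trans (im_le_Cmod _) _; apply: ebd.
  have {}l0 := l0 b0 ltac:(lra) bd0; have {}l1 := l1 b1 ltac:(lra) bd1.
  have tri : Cmod (phi b0 - phi b1 - l) < 3 * e4.
    have -> : (phi b0 - phi b1 - l)%C = ((phi b0 - S N) + (S N - l) + - (phi b1 - RtoC 0))%C by ring.
    have := Cmod_triangle (phi b0 - S N + (S N - l)) (- (phi b1 - RtoC 0)).
    have := Cmod_triangle (phi b0 - S N) (S N - l); rewrite Cmod_opp; lra.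
  have tr := Rle_trans _ _ _ (re_le_Cmod _) (Rlt_le _ _ tri).
  have ti := Rle_trans _ _ _ (im_le_Cmod _) (Rlt_le _ _ tri).
  rewrite (_ : Re (phi b0 - phi b1 - l) = Re (phi b0) - Re (phi b1) - Re l) // in tr.
  rewrite (_ : Im (phi b0 - phi b1 - l) = Im (phi b0) - Im (phi b1) - Im l) // in ti.
  apply: HP; split; rewrite /ball /= /AbsRing_ball /= /abs /minus /plus /opp /=.
    have := Rabs_triang (RInt (fun x => Re (f x)) b0 b1 - (Re (phi b0) - Re (phi b1)))
      (Re (phi b0) - Re (phi b1) - Re l).
    rewrite (_ : _ + _ = RInt (fun x => Re (f x)) b0 b1 + - Re l); last by ring.
    by rewrite -[fst l]/(Re l); rewrite /e4 in H2 tr *; lra.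
  have := Rabs_triang (RInt (fun x => Im (f x)) b0 b1 - (Im (phi b0) - Im (phi b1)))
    (Im (phi b0) - Im (phi b1) - Im l).
  rewrite (_ : _ + _ = RInt (fun x => Im (f x)) b0 b1 + - Im l); last by ring.
  by rewrite -[snd l]/(Im l); rewrite /e4 in H2 ti *; lra.
apply: (Filter_prod _ _ _ (fun b0 => 0 < b0 < / 2 /\ b0 < d0) (fun b1 => / 2 < b1 < 1 /\ 1 - d1 < b1)).
- have p : 0 < Rmin (/ 2) d0 by apply: Rmin_glb_lt => //; lra.
  exists (mkposreal _ p) => x; rewrite /ball /= /AbsRing_ball /= /abs /minus /plus /opp /=.
  rewrite Ropp_0 Rplus_0_r => xd x0; rewrite Rabs_pos_eq in xd; last lra.
  by have := Rmin_l (/ 2) d0; have := Rmin_r (/ 2) d0; lra.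
- have p : 0 < Rmin (/ 2) d1 by apply: Rmin_glb_lt => //; lra.
  exists (mkposreal _ p) => x; rewrite /ball /= /AbsRing_ball /= /abs /minus /plus /opp /=.
  move=> xd x0; rewrite Rabs_left in xd; last lra.
  by have := Rmin_l (/ 2) d1; have := Rmin_r (/ 2) d1; lra.
move=> b0 b1 [? ?] [? ?].
by exists (RInt (fun x => Re (f x)) b0 b1, RInt (fun x => Im (f x)) b0 b1); apply: main.
Qed.

(** * Convergence and complex differentiability of the dual series *)

Lemma Ccvg_ext S T l : (forall N, S N = T N) -> Ccvg S l -> Ccvg T l.
Proof. by move=> ST Sl eps /Sl[N0 H]; exists N0 => N /H; rewrite ST. Qed.

Lemma Ccvg_const l : Ccvg (fun=> l) l.
Proof. by move=> eps e0; exists 0%N => N _; rewrite /Cminus Cplus_opp_r Cmod_0. Qed.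

Lemma Ccvg_plus S T k l : Ccvg S k -> Ccvg T l -> Ccvg (fun N => S N + T N)%C (k + l)%C.
Proof.
move=> Sk Tl eps e0; have e2 : 0 < eps / 2 by lra.
have [N1 H1] := Sk _ e2; have [N2 H2] := Tl _ e2; exists (N1 + N2)%N => N NN.
have := H1 N ltac:(lia); have := H2 N ltac:(lia).
have -> : (S N + T N - (k + l))%C = ((S N - k) + (T N - l))%C by ring.
have := Cmod_triangle (S N - k) (T N - l); lra.
Qed.

Lemma Ccvg_mull c S l : Ccvg S l -> Ccvg (fun N => c * S N)%C (c * l)%C.
Proof.
move=> Sl eps e0; have c0 := Cmod_ge_0 c.
have e1 : 0 < eps / (Cmod c + 1) by apply: Rdiv_lt_0_compat; lra.
have [N0 H] := Sl _ e1; exists N0 => N /H{}H.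
have -> : (c * S N - c * l)%C = (c * (S N - l))%C by ring.
rewrite Cmod_mult; apply: Rle_lt_trans (Rmult_le_compat_l _ _ _ c0 (Rlt_le _ _ H)) _.
apply: (Rmult_lt_reg_r (Cmod c + 1)); first lra.
have -> : Cmod c * (eps / (Cmod c + 1)) * (Cmod c + 1) = Cmod c * eps by field; lra.
nra.
Qed.

Lemma Ccvg_big (I : Type) (r : seq I) (p : pred I) (S : I -> nat -> C) (l : I -> C) :
  (forall i, p i -> Ccvg (S i) (l i)) ->
  Ccvg (fun N => \big[Cplus/RtoC 0]_(i <- r | p i) S i N) (\big[Cplus/RtoC 0]_(i <- r | p i) l i).
Proof.
move=> H; elim: r => [|i r IH].
  by rewrite big_nil; apply: Ccvg_ext (Ccvg_const _) => N; rewrite big_nil.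
rewrite big_cons; case: ifP => pi.
  by apply: Ccvg_ext (Ccvg_plus (H i pi) IH) => N; rewrite big_cons pi.
by apply: Ccvg_ext IH => N; rewrite big_cons pi.
Qed.

Lemma Ccvg_le S l B : Ccvg S l -> (forall N, Cmod (S N) <= B) -> Cmod l <= B.
Proof.
move=> Sl SB; apply: Rnot_lt_le => lB.
have [N0 /(_ N0 (leqnn _))] := Sl (Cmod l - B) ltac:(lra).
have := SB N0; have := Cmod_triangle (S N0) (- (S N0 - l)).
have -> : (S N0 + - (S N0 - l))%C = l by ring.
rewrite Cmod_opp; lra.
Qed.

Lemma Ccvg_Re_Im S l : is_lim_seq (fun N => Re (S N)) (Re l) ->
  is_lim_seq (fun N => Im (S N)) (Im l) -> Ccvg S l.
Proof.
move=> Hr Hi eps e0; have e2 : 0 < eps / 2 by lra.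
have [N1 H1] := Hr _ (locally_ball _ (mkposreal _ e2)).
have [N2 H2] := Hi _ (locally_ball _ (mkposreal _ e2)).
exists (N1 + N2)%N => N NN; apply: Rle_lt_trans (Cmod_le_Re_Im _) _.
have h1 : Rabs (Re (S N) - Re l) < eps / 2 by apply: H1; lia.
have h2 : Rabs (Im (S N) - Im l) < eps / 2 by apply: H2; lia.
rewrite (_ : Re (S N - l) = Re (S N) - Re l) //.
rewrite (_ : Im (S N - l) = Im (S N) - Im l) //; lra.
Qed.

Lemma Ccvg_Re S l : Ccvg S l -> is_lim_seq (fun N => Re (S N)) (Re l).
Proof.
move=> Sl P [eps HP]; have [N0 H] := Sl _ (cond_pos eps); exists N0 => N NN.
apply: HP; apply: Rle_lt_trans (H N _); last by apply/leP.
exact: (re_le_Cmod (S N - l)%C).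
Qed.

Lemma Ccvg_Im S l : Ccvg S l -> is_lim_seq (fun N => Im (S N)) (Im l).
Proof.
move=> Sl P [eps HP]; have [N0 H] := Sl _ (cond_pos eps); exists N0 => N NN.
apply: HP; apply: Rle_lt_trans (H N _); last by apply/leP.
exact: (im_le_Cmod (S N - l)%C).
Qed.

Lemma Ccvg_CSum r f l : Ccvg (dec_sum r f) l -> CSum r f = l.
Proof.
move=> H; rewrite /CSum (is_lim_seq_unique _ _ (Ccvg_Re H)) (is_lim_seq_unique _ _ (Ccvg_Im H)).
by case: (l).
Qed.

Lemma Ccvg_dominated (f : nat -> C) (u : nat -> R) B :
  (forall n, Cmod (f n) <= u n) -> (forall N, \rsum_(n < N) u n <= B) ->
  exists l, Ccvg (fun N => \csum_(n < N) f n) l.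
Proof.
move=> fu uB.
have su : ex_series u.
  have [|N|l Hl] := ex_finite_lim_seq_incr (sum_n u) B.
  - move=> n; rewrite sum_Sn /plus /=; have := fu n.+1; have := Cmod_ge_0 (f n.+1); lra.
  - by rewrite sum_nE.
  - by exists l.
have part (g : C -> R) : g (RtoC 0) = 0 -> (forall x y, g (x + y)%C = g x + g y) -> (forall z, Rabs (g z) <= Cmod z) ->
    exists l : R, is_lim_seq (fun N => g (\csum_(n < N) f n)) l.
  move=> g0 gD gle.
  have [l Hl] : ex_series (fun n => g (f n)).
    apply: (ex_series_le (V := R_CompleteNormedModule)) su => n.
    exact: Rle_trans (gle _) (fu n).
  exists l; apply/is_lim_seq_incr_1.
  apply: is_lim_seq_ext (Hl : is_lim_seq _ l) => N.
  rewrite sum_nE; symmetry; apply: (big_morph g) => //.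
have [lr Hr] := part Re erefl (fun x y => erefl) re_le_Cmod.
have [li Hi] := part Im erefl (fun x y => erefl) im_le_Cmod.
exists (lr, li); exact: Ccvg_Re_Im.
Qed.

(** Telescoping of n^(-3/2) <= 6 (1 / sqrt n - 1 / sqrt (n + 1)); the 6 comes from sqrt (n + 1) <= 2
    sqrt n. *)
Lemma sum_inv_pow32 N : \rsum_(n < N) (/ (INR n.+1 * sqrt (INR n.+1))) <= 6 - 6 / sqrt (INR N.+1).
Proof.
elim: N => [|N IH]; first by rewrite big_ord0 /= sqrt_1; lra.
rewrite big_ord_recr /=; apply: Rle_trans (Rplus_le_compat_r _ _ _ IH) _.
rewrite -/(INR N.+1) -/(INR N.+2) [INR N.+2]S_INR.
set x := INR N.+1; have x1 : 1 <= x by rewrite /x S_INR; have := pos_INR N; lra.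
set s := sqrt x; set t := sqrt (x + 1).
have s0 : 0 < s by apply: sqrt_lt_R0; lra.
have t0 : 0 < t by apply: sqrt_lt_R0; lra.
have ss : s * s = x by apply: sqrt_sqrt; lra.
have tt : t * t = x + 1 by apply: sqrt_sqrt; lra.
have ts : t <= 2 * s by nra.
have st : s <= t by nra.
have E : / s - / t = / (s * t * (s + t)).
  have -> : / s - / t = (t * t - s * s) / (s * t * (s + t)) by field; lra.
  by rewrite tt ss; field; nra.
have : / (x * s) <= 6 * / (s * t * (s + t)).
  have -> : 6 * / (s * t * (s + t)) = / (s * (t * (s + t)) / 6) by field; nra.
  apply: Rinv_le_contravar; first by apply: Rdiv_lt_0_compat; [nra|lra].
  rewrite -ss; have : t * (s + t) <= 6 * (s * s) by nra.
  nra.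
rewrite -E /Rdiv; lra.
Qed.

(** * First-order expansions dominated by a weight *)

Section DominatedJets.

Variables (a : C) (rho : R).

(** [g1] is the derivative at h = 0. The shape is stable under products and sums over n, hence under
    nested sums, and a summable weight then allows term-by-term differentiation. The index 0 is left
    out because n - a may vanish there. *)
Definition jet_dominated (g : nat -> C -> C) (w : nat -> R) : Prop :=
  exists (g1 : nat -> C) (M : R), 0 <= M /\ forall n h, (0 < n)%N -> Cmod h < rho ->
    [/\ Cmod (g n h) <= M * w n, Cmod (g1 n) <= M * w n
      & Cmod (g n h - g n (RtoC 0) - h * g1 n) <= M * Cmod h ^ 2 * w n].

Hypothesis rho_bounds : 0 < rho <= 1.

Lemma jet_dominated_const (u : nat -> R) : (forall n, 0 <= u n) -> jet_dominated (fun n _ => RtoC (u n)) u.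
Proof.
move=> u0; exists (fun=> RtoC 0), 1; split; first lra; move=> n h _ _; split.
- by rewrite Cmod_R Rabs_pos_eq //; lra.
- by rewrite Cmod_0; have := u0 n; lra.
- have -> : (RtoC (u n) - RtoC (u n) - h * RtoC 0)%C = RtoC 0 by ring.
  rewrite Cmod_0; apply: Rmult_le_pos => //; have := pow_le _ 2 (Cmod_ge_0 h); lra.
Qed.

Lemma jet_dominated_mult f g u w : jet_dominated f u -> jet_dominated g w ->
  jet_dominated (fun n h => f n h * g n h)%C (fun n => u n * w n).
Proof.
move=> [f1 [M [M0 HM]]] [g1 [Q [Q0 HQ]]].
(* 4 = 1 + 2 + 1 for the three terms of the remainder below; the 2 comes from the increment [dg],
   where |h| <= 1 is used. *)
exists (fun n => f1 n * g n (RtoC 0) + f n (RtoC 0) * g1 n)%C, (4 * M * Q); split; first nra.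
move=> n h n0 hr.
have [z1 z2 z3] := HM n (RtoC 0) n0 ltac:(rewrite Cmod_0; lra).
have [y1 y2 y3] := HQ n (RtoC 0) n0 ltac:(rewrite Cmod_0; lra).
have [a1 a2 a3] := HM n h n0 hr; have [b1 b2 b3] := HQ n h n0 hr.
have h0 := Cmod_ge_0 h.
have mm z y B1 B2 : Cmod z <= B1 -> Cmod y <= B2 -> Cmod (z * y) <= B1 * B2.
  by move=> ? ?; rewrite Cmod_mult; apply: Rmult_le_compat => //; apply: Cmod_ge_0.
have u0 : 0 <= M * u n by apply: Rle_trans z1; apply: Cmod_ge_0.
have w0 : 0 <= Q * w n by apply: Rle_trans y1; apply: Cmod_ge_0.
have P0 : 0 <= (M * u n) * (Q * w n) by apply: Rmult_le_pos.
split.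
- by apply: Rle_trans (mm _ _ _ _ a1 b1) _; lra.
- apply: Rle_trans (Cmod_triangle _ _) _.
  have := mm _ _ _ _ a2 y1; have := mm _ _ _ _ z1 b2; lra.
have dg : Cmod (g n h - g n (RtoC 0)) <= 2 * Cmod h * (Q * w n).
  have -> : (g n h - g n (RtoC 0))%C = (g n h - g n (RtoC 0) - h * g1 n + h * g1 n)%C by ring.
  apply: Rle_trans (Cmod_triangle _ _) _.
  have := mm _ _ _ _ (Rle_refl (Cmod h)) b2.
  have : Cmod h ^ 2 * (Q * w n) <= Cmod h * (Q * w n).
    apply: Rmult_le_compat_r => //; have h1 : Cmod h <= 1 by lra.
    by have := Rmult_le_compat_l _ _ _ h0 h1; rewrite /pow; lra.
  lra.
have -> : (f n h * g n h - f n (RtoC 0) * g n (RtoC 0) -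
    h * (f1 n * g n (RtoC 0) + f n (RtoC 0) * g1 n))%C =
  ((f n h - f n (RtoC 0) - h * f1 n) * g n h + (h * f1 n) * (g n h - g n (RtoC 0)) +
   f n (RtoC 0) * (g n h - g n (RtoC 0) - h * g1 n))%C by ring.
apply: Rle_trans (Cmod_triangle _ _) _.
apply: Rle_trans (Rplus_le_compat_r _ _ _ (Cmod_triangle _ _)) _.
have c1 := mm _ _ _ _ a3 b1.
have c2 := mm _ _ _ _ (mm _ _ _ _ (Rle_refl (Cmod h)) a2) dg.
have c3 := mm _ _ _ _ z1 b3.
nra.
Qed.

(** The sum includes the index 0, on which [jet_dominated] says nothing: there [g] must be constant,
    and M + 1 covers its value. *)
Lemma jet_dominated_sum g w : (forall n, 0 <= w n) ->
  (forall h, g 0%N h = g 0%N (RtoC 0)) -> Cmod (g 0%N (RtoC 0)) <= w 0%N ->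
  jet_dominated g w -> jet_dominated (fun N h => \csum_(n < N) g n h) (fun N => \rsum_(n < N) w n).
Proof.
move=> w0 gc gw [g1 [M [M0 HM]]].
pose g1' n := if (n == 0)%N then RtoC 0 else g1 n.
have H n h : Cmod h < rho -> [/\ Cmod (g n h) <= (M + 1) * w n, Cmod (g1' n) <= (M + 1) * w n
      & Cmod (g n h - g n (RtoC 0) - h * g1' n) <= (M + 1) * Cmod h ^ 2 * w n].
  move=> hr; have h2 := pow_le _ 2 (Cmod_ge_0 h); have wn := w0 n.
  have h2w : 0 <= Cmod h ^ 2 * w n by apply: Rmult_le_pos.
  rewrite /g1'; case: posnP => [->|n0].
    have w00 := w0 0%N; rewrite gc Cmod_0; split; [nra|nra|].
    have -> : (g 0%N (RtoC 0) - g 0%N (RtoC 0) - h * RtoC 0)%C = RtoC 0 by ring.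
    rewrite Cmod_0; apply: Rmult_le_pos => //; nra.
  have [a1 a2 a3] := HM n h n0 hr; split; nra.
exists (fun N => \csum_(n < N) g1' n), (M + 1).
split; first lra; move=> N h _ hr; split.
- rewrite big_distrr /=; apply: Rle_trans (Cmod_sum _) _; apply: rsum_le => n.
  by have [] := H n h hr.
- rewrite big_distrr /=; apply: Rle_trans (Cmod_sum _) _; apply: rsum_le => n.
  by have [] := H n h hr.
have -> : (\csum_(n < N) g n h - \csum_(n < N) g n (RtoC 0) - h * \csum_(n < N) g1' n)%C =
   \csum_(n < N) (g n h - g n (RtoC 0) - h * g1' n)%C.
  elim: N => [|N IH]; first by rewrite !big_ord0; ring.
  by rewrite !big_ord_recr -IH /=; ring.
rewrite big_distrr /=; apply: Rle_trans (Cmod_sum _) _; apply: rsum_le => n.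
by have [] := H n h hr.
Qed.

Variable c : R.
Hypotheses (c_gt0 : 0 < c)
  (dist_a : forall n h, Cmod h < rho -> c * INR n.+1 <= Cmod (RtoC (INR n.+1) - (a + h))%C).

Lemma jet_dominated_inv : jet_dominated (fun n h => / (RtoC (INR n) - (a + h)))%C (fun n => / INR n).
Proof.
(* With s = n - a and t = s - h the remainder is exactly h^2 / (s^2 t). The three constants serve 1
   / t, 1 / s^2 and 1 / (s^2 t); surplus powers of 1 / n are at most 1. *)
exists (fun n => / (RtoC (INR n) - a) * / (RtoC (INR n) - a))%C, (/ c + / (c * c) + / (c * c * c)).
have i1 : 0 < / c by apply: Rinv_0_lt_compat.
have i2 : 0 < / (c * c) by apply: Rinv_0_lt_compat; nra.
have i3 : 0 < / (c * c * c) by apply: Rinv_0_lt_compat; apply: Rmult_lt_0_compat; nra.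
split; first lra; case=> // n h _ hr.
have n0 := INR_S_gt0 n; have h2 := pow_le _ 2 (Cmod_ge_0 h).
have d0 := dist_a n hr; have d1 : c * INR n.+1 <= Cmod (RtoC (INR n.+1) - (a + RtoC 0)).
  by apply: dist_a; rewrite Cmod_0; lra.
rewrite Cplus_0_r in d1 *; set s := (RtoC (INR n.+1) - a)%C in d1 *.
set t := (RtoC (INR n.+1) - (a + h))%C in d0 *.
have cn : 0 < c * INR n.+1 by nra.
have s0 : s <> RtoC 0 by apply/Cmod_gt_0; lra.
have t0 : t <> RtoC 0 by apply/Cmod_gt_0; lra.
have is1 : Cmod (/ s) <= / c * / INR n.+1.
  by rewrite Cmod_inv // -Rinv_mult; apply: Rinv_le_contravar.
have it : Cmod (/ t) <= / c * / INR n.+1.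
  by rewrite Cmod_inv // -Rinv_mult; apply: Rinv_le_contravar.
set x := / INR n.+1 in is1 it *.
have x0 : 0 < x by apply: Rinv_0_lt_compat.
have x1 : x <= 1.
  rewrite -Rinv_1; apply: Rinv_le_contravar; first lra.
  by rewrite S_INR; have := pos_INR n; lra.
have iss : Cmod (/ s * / s) <= / (c * c) * x.
  rewrite Cmod_mult; apply: (Rle_trans _ ((/ c * x) * (/ c * x))).
    by apply: Rmult_le_compat => //; apply: Cmod_ge_0.
  have -> : / c * x * (/ c * x) = / c * / c * (x * x) by ring.
  by rewrite Rinv_mult; apply: Rmult_le_compat_l; nra.
split.
- nra.
- nra.
have -> : (/ t - / s - h * (/ s * / s))%C = (h * h * (/ s * / s * / t))%C.
  have -> : t = (s - h)%C by rewrite /t /s; ring.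
  by field; split=> // E; apply: t0; rewrite -E /t /s; ring.
rewrite Cmod_mult (Cmod_mult h) (Cmod_mult (_ * _)%C (/ t)).
have : Cmod (/ s * / s) * Cmod (/ t) <= / (c * c) * x * (/ c * x).
  by apply: Rmult_le_compat => //; apply: Cmod_ge_0.
have -> : / (c * c) * x * (/ c * x) = / (c * c * c) * x * x by field; lra.
move=> H; have hh : 0 <= Cmod h * Cmod h by have := Cmod_ge_0 h; nra.
apply: Rle_trans (Rmult_le_compat_l _ _ _ hh H) _.
have -> : (/ c + / (c * c) + / (c * c * c)) * Cmod h ^ 2 * x =
   Cmod h * Cmod h * ((/ c + / (c * c) + / (c * c * c)) * x) by ring.
apply: Rmult_le_compat_l => //.
have P1 : 0 <= / c * x by nra.
have P2 : 0 <= / (c * c) * x by nra.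
have P3 : 0 <= / (c * c * c) * x by nra.
have := Rmult_le_compat_l _ _ _ P3 x1; lra.
Qed.

Lemma jet_dominated_ext f g u w :
  (forall n h, (0 < n)%N -> Cmod h < rho -> f n h = g n h) ->
  (forall n, (0 < n)%N -> u n = w n) -> jet_dominated f u -> jet_dominated g w.
Proof.
move=> fg uw [f1 [M [M0 HM]]]; exists f1, M; split=> // n h n0 hr.
have r0 : Cmod (RtoC 0) < rho by rewrite Cmod_0; lra.
by rewrite -!fg // -uw //; apply: HM.
Qed.

Lemma jet_dominated_inv_pow e :
  jet_dominated (fun n h => (/ (RtoC (INR n) - (a + h))) ^ e)%C (fun n => (/ INR n) ^ e).
Proof.
elim: e => [|e IH]; last exact: jet_dominated_mult jet_dominated_inv IH.
by apply: jet_dominated_ext (jet_dominated_const (fun=> Rle_0_1)).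
Qed.

End DominatedJets.

(** The part with n_1 = n of zeta or T at beta = 1 - a; equivalently [dcoef] at p = 0. *)
Fixpoint ccoef (b : bool) (a : C) (k : seq nat) (n : nat) : C :=
  if k is e :: k' then
    (RtoC (weight_at b (size k) n) / (RtoC (INR n) - a) ^ e * \csum_(i < n) ccoef b a k' i)%C
  else if n == 0%N then RtoC 1 else RtoC 0.

Lemma ccoef_cons b a e k n : ccoef b a (e :: k) n =
  (RtoC (weight_at b (size k).+1 n) / (RtoC (INR n) - a) ^ e * \csum_(i < n) ccoef b a k i)%C.
Proof. by []. Qed.

Lemma ccoef_at0 b a e k : ccoef b a (e :: k) 0 = RtoC 0.
Proof. by rewrite /= big_ord0 Cmult_0_r. Qed.

Section Holomorphy.

Variables (b : bool) (a : C) (rho c : R).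
Hypotheses (rho_bounds : 0 < rho <= 1) (c_gt0 : 0 < c)
  (dist_a : forall n h, Cmod h < rho -> c * INR n.+1 <= Cmod (RtoC (INR n.+1) - (a + h))%C).

(** The weight is the unshifted real coefficient, so summability has to be shown for that one
    only. *)
Lemma jet_dominated_ccoef k : jet_dominated rho (fun n h => ccoef b (a + h) k n) (coef b k).
Proof.
have sum l : jet_dominated rho (fun n h => ccoef b (a + h) l n) (coef b l) ->
    jet_dominated rho (fun N h => \csum_(n < N) ccoef b (a + h) l n)%C (fun N => \rsum_(n < N) coef b l n).
  apply: jet_dominated_sum => // [n|h|]; first exact: coef_ge0.
    by case: l => // e l; rewrite !ccoef_at0.
  case: l => [|e l]; first by rewrite /coef /= Cmod_1; lra.
  by rewrite ccoef_at0 Cmod_0; apply: coef_ge0.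
elim: k => [|e k IH].
  apply: (@jet_dominated_ext rho rho_bounds (fun _ _ => RtoC 0) _ (fun=> 0)); last first.
  - by apply: (@jet_dominated_const rho (fun=> 0)) => _; lra.
  - by case.
  - by case.
have H := jet_dominated_mult rho_bounds (jet_dominated_mult rho_bounds
  (jet_dominated_const rho (weight_at_ge0 b (size k).+1))
  (jet_dominated_inv_pow rho_bounds c_gt0 dist_a e)) (sum _ IH).
apply: (jet_dominated_ext rho_bounds _ _ H) => [[//|n] h _ hr|[//|n] _].
  have s0 : (RtoC (INR n.+1) - (a + h))%C <> RtoC 0.
    by move=> E; have := dist_a n hr; rewrite E Cmod_0; have := INR_S_gt0 n; nra.
  by rewrite ccoef_cons Cpow_inv.
by rewrite coef_cons pow_inv.
Qed.

Definition quadratic_at (F : C -> C) : Prop :=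
  exists (l : C) (M : R), 0 <= M /\ forall h, Cmod h < rho ->
    Cmod (F (a + h)%C - F a - h * l) <= M * Cmod h ^ 2.

(** The quadratic bound on the remainders of the partial sums is uniform in N and passes to the
    limit. *)
Lemma jet_dominated_series (g : nat -> C -> C) (w : nat -> R) B :
  (forall n, 0 <= w n) -> (forall N, \rsum_(n < N) w n <= B) ->
  (forall h, g 0%N h = RtoC 0) -> jet_dominated rho g w ->
  (forall h, Cmod h < rho -> exists l, Ccvg (fun N => \csum_(n < N) g n h) l) /\
  forall F, (forall h, Cmod h < rho -> Ccvg (fun N => \csum_(n < N) g n h) (F (a + h)%C)) ->
    quadratic_at F.
Proof.
move=> w0 wB g0 [g1 [M [M0 HM]]]; have B0 : 0 <= B by have := wB 0%N; rewrite big_ord0.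
have MB u (K : R) : 0 <= K -> (forall n, Cmod (u n) <= K * w n) ->
    forall N, Cmod (\csum_(n < N) u n) <= K * B.
  move=> K0 uw N; apply: Rle_trans (Cmod_sum _) _.
  apply: (Rle_trans _ (\rsum_(n < N) (K * w n))); first by apply: rsum_le.
  by rewrite -big_distrr; apply: Rmult_le_compat_l.
have cvg u K : 0 <= K -> (forall n, Cmod (u n) <= K * w n) ->
    exists l, Ccvg (fun N => \csum_(n < N) u n) l.
  move=> K0 uw; apply: (@Ccvg_dominated u (fun n => K * w n) (K * B)) => // N.
  by rewrite -big_distrr; apply: Rmult_le_compat_l.
pose g1' n := if (n == 0)%N then RtoC 0 else g1 n.
have H n h : Cmod h < rho -> [/\ Cmod (g n h) <= M * w n, Cmod (g1' n) <= M * w n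
      & Cmod (g n h - g n (RtoC 0) - h * g1' n) <= M * Cmod h ^ 2 * w n].
  move=> hr; have h2 := pow_le _ 2 (Cmod_ge_0 h); have wn := w0 n.
  have Mw : 0 <= M * w n by apply: Rmult_le_pos.
  rewrite /g1'; case: n wn Mw => [|n] wn Mw /=; last exact: HM.
  rewrite !g0 Cmod_0; split=> //.
  have -> : (RtoC 0 - RtoC 0 - h * RtoC 0)%C = RtoC 0 by ring.
  by rewrite Cmod_0; apply: Rmult_le_pos => //; apply: Rmult_le_pos.
split.
  move=> h hr; apply: (cvg (fun n => g n h) M M0) => n; by have [] := H n h hr.
move=> F FH.
have r0 : Cmod (RtoC 0) < rho by rewrite Cmod_0; lra.
have [l Hl] : exists l, Ccvg (fun N => \csum_(n < N) g1' n) l.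
  by apply: (cvg _ M M0) => n; have [] := H n (RtoC 0) r0.
exists l, (M * B); split; first exact: Rmult_le_pos.
move=> h hr; have h2 := pow_le _ 2 (Cmod_ge_0 h).
have F0 := FH _ r0; rewrite Cplus_0_r in F0.
have HC := Ccvg_plus (FH _ hr) (Ccvg_plus (Ccvg_mull (RtoC (-1)) F0) (Ccvg_mull (- h) Hl)).
have -> : (F (a + h)%C - F a - h * l)%C = (F (a + h)%C + (RtoC (-1) * F a + - h * l))%C by ring.
apply: Ccvg_le HC _ => N; cbv beta; have -> : M * B * Cmod h ^ 2 = M * Cmod h ^ 2 * B by ring.
have -> : (\csum_(n < N) g n h + (RtoC (-1) * (\csum_(n < N) g n (RtoC 0)) + - h * (\csum_(n < N) g1' n)))%C =
   \csum_(n < N) (g n h - g n (RtoC 0) - h * g1' n)%C.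
  elim: N => [|N IH]; first by rewrite !big_ord0; ring.
  by rewrite !big_ord_recr -IH /=; ring.
apply: (MB (fun n => g n h - g n (RtoC 0) - h * g1' n)%C); first exact: Rmult_le_pos.
by move=> n; have [] := H n h hr.
Qed.

(** A leading entry of at least 2 leaves a multiple of sqrt n / n^2 = n^(-3/2). *)
Lemma coef_summable e (k : seq nat) : 0%N \notin k ->
  exists B, forall N, \rsum_(n < N) coef b (e.+2 :: k) n <= B.
Proof.
move=> k0; have [M [M0 HM]] := @coef_le_sqrt b 2%N k k0.
exists (6 * M) => -[|N]; first by rewrite big_ord0; lra.
rewrite big_ord_recl coef_at0 Rplus_0_l.
apply: (Rle_trans _ (\rsum_(n < N) (M * / (INR n.+1 * sqrt (INR n.+1))))).
  apply: rsum_le => n; rewrite lift0.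
  apply: Rle_trans (@coef_le_head b e.+2 2%N k n.+1 _) _ => //.
  apply: Rle_trans (HM n) _; have n0 := INR_S_gt0 n.
  have s0 := sqrt_lt_R0 _ n0; have ss := sqrt_sqrt _ (Rlt_le _ _ n0).
  apply: Req_le; rewrite -{2 3}ss; move: s0 ss; set s := sqrt _ => s0 ss.
  by field; lra.
rewrite -big_distrr /=; have := sum_inv_pow32 N; have := sqrt_lt_R0 _ (INR_S_gt0 N) => s0.
have i0 : 0 < 6 / sqrt (INR N.+1) by apply: Rdiv_lt_0_compat; lra.
move=> H; apply: Rle_trans (Rmult_le_compat_l _ _ _ M0 H) _; nra.
Qed.

Lemma ccoef_series e (k : seq nat) : 0%N \notin k ->
  (exists l, Ccvg (fun N => \csum_(n < N) ccoef b a (e.+2 :: k) n) l) /\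
  forall F, (forall h, Cmod h < rho ->
      Ccvg (fun N => \csum_(n < N) ccoef b (a + h) (e.+2 :: k) n)%C (F (a + h)%C)) ->
    quadratic_at F.
Proof.
move=> /(coef_summable e)[B HB].
have [] := @jet_dominated_series (fun n h => ccoef b (a + h)%C (e.+2 :: k) n) (coef b (e.+2 :: k)) B.
- exact: coef_ge0.
- exact: HB.
- by move=> h; rewrite ccoef_at0.
- exact: jet_dominated_ccoef.
move=> /(_ (RtoC 0)); rewrite Cmod_0 Cplus_0_r => /(_ (proj1 rho_bounds)) H1 H2; split=> //.
Qed.

Lemma quadratic_at_ex_derive F : quadratic_at F ->
  ex_derive (K := C_AbsRing) (V := C_NormedModule) F a.
Proof.
move=> [l [M [M0 HM]]]; exists l; split; first exact: is_linear_scal_l.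
move=> x Hx eps; have <- := is_filter_lim_locally_unique (V := AbsRing_NormedModule C_AbsRing) _ _ Hx.
have e0 := cond_pos eps.
have p : 0 < Rmin rho (eps / (M + 1)) by apply: Rmin_glb_lt; [lra|apply: Rdiv_lt_0_compat; lra].
exists (mkposreal _ p) => y; rewrite /ball /= /AbsRing_ball /= => ya.
have {}ya : Cmod (y - a) < Rmin rho (eps / (M + 1)) by [].
have y1 := Rlt_le_trans _ _ _ ya (Rmin_l _ _).
have y2 := Rlt_le_trans _ _ _ ya (Rmin_r _ _).
have := HM (y - a)%C y1; have -> : (a + (y - a))%C = y by ring.
move=> H; change (Cmod (F y - F a - (y - a) * l) <= eps * Cmod (y - a)).
apply: Rle_trans H _; have h0 := Cmod_ge_0 (y - a); set d := Cmod (y - a) in y2 h0 *.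
have : d * (M + 1) < eps.
  have := Rmult_lt_compat_r (M + 1) _ _ ltac:(lra) y2.
  by have -> : eps / (M + 1) * (M + 1) = eps by field; lra.
rewrite /pow; nra.
Qed.

Lemma quadratic_at_big (I : Type) (r : seq I) (p : pred I) (u : I -> C) (F : I -> C -> C) :
  (forall i, p i -> quadratic_at (F i)) ->
  quadratic_at (fun z => \big[Cplus/RtoC 0]_(i <- r | p i) (u i * F i z)%C).
Proof.
move=> HF; elim: r => [|i r [l [M [M0 HM]]]].
  exists (RtoC 0), 0; split; first lra; move=> h _; rewrite !big_nil.
  have -> : (RtoC 0 - RtoC 0 - h * RtoC 0)%C = RtoC 0 by ring.
  by rewrite Cmod_0; lra.
case pi: (p i); last by exists l, M; split=> // h hr; rewrite !big_cons pi; apply: HM.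
have [k [Q [Q0 HQ]]] := HF i pi; have u0 := Cmod_ge_0 (u i).
exists (u i * k + l)%C, (Cmod (u i) * Q + M); split; first nra.
move=> h hr; rewrite !big_cons pi; have := HM h hr; have := HQ h hr.
set S := \big[_/_]_(_ <- _ | _) _; set T := \big[_/_]_(_ <- _ | _) _ => h1 h2.
have -> : (u i * F i (a + h)%C + S - (u i * F i a + T) - h * (u i * k + l))%C =
  (u i * (F i (a + h)%C - F i a - h * k) + (S - T - h * l))%C by ring.
apply: Rle_trans (Cmod_triangle _ _) _; rewrite Cmod_mult.
have := Rmult_le_compat_l _ _ _ u0 h1; lra.
Qed.

End Holomorphy.

(** * Comparison with the sums of the statement *)

Arguments ccoef : simpl never.

Lemma big_tuple_cons (R : Type) (idx : R) (op : Monoid.com_law idx) (T : finType) n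
    (P : pred (seq T)) (F : seq T -> R) :
  \big[op/idx]_(t : n.+1.-tuple T | P t) F t =
  \big[op/idx]_(x : T) \big[op/idx]_(t : n.-tuple T | P (x :: t)) F (x :: t).
Proof.
rewrite pair_big_dep /= (reindex (fun q : T * n.-tuple T => [tuple of q.1 :: q.2])) //=.
exists (fun t : n.+1.-tuple T => (thead t, [tuple of behead t])) => [[x t]|t] _ /=.
  by congr pair; apply: val_inj.
by rewrite -tuple_eta.
Qed.

Lemma big_tuple_nil (R : Type) (idx : R) (op : Monoid.com_law idx) (T : finType)
    (P : pred (seq T)) (F : seq T -> R) :
  \big[op/idx]_(t : 0.-tuple T | P t) F t = if P [::] then F [::] else idx.
Proof.
by rewrite big_mkcond (big_pred1 [tuple]) // => t; rewrite (tuple0 t) /= eqxx.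
Qed.

Lemma B_coef_nil j : B_coef [::] j = 1%N.
Proof. by case: j => [|x j]; apply: big_nil. Qed.

Lemma B_coef_cons e k x j : B_coef (e :: k) (x :: j) = ('C(e + x - 1, x) * B_coef k j)%N.
Proof. exact: big_cons. Qed.

Lemma addc_cons e k x j : addc (e :: k) (x :: j) = (e + x)%N :: addc k j.
Proof. by []. Qed.

Lemma size_addc k j : size j = size k -> size (addc k j) = size k.
Proof. by move=> E; rewrite size_map size_zip E minnn. Qed.

(** Each (n_i - a + eps)^(-k_i) is expanded, and a distribution [j] of the exponent p over the
    factors has the product of binomials B(k; j). The range M is kept apart from p, which shrinks
    along the recursion. *)
Lemma dcoef_weighted b a M k p n : (p <= M)%N ->
  dcoef b a k p n = (RtoC ((-1) ^ p) *
    \big[Cplus/RtoC 0]_(j : (size k).-tuple 'I_M.+1 | sumn (map val j) == p)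
      (RtoC (INR (B_coef k (map val j))) * ccoef b a (addc k (map val j)) n))%C.
Proof.
elim: k p n => [|e k IH] p n pM.
  rewrite (big_tuple_nil _ (fun j => sumn (map val j) == p)
    (fun j => RtoC (INR (B_coef [::] (map val j))) * ccoef b a (addc [::] (map val j)) n)%C).
  rewrite B_coef_nil /dcoef /ccoef /=.
  by case: p pM => [|p] _ /=; rewrite ?andbT ?andbF; case: (n == 0)%N => /=; ring.
rewrite dcoef_cons /= (big_tuple_cons _ _ (fun j => sumn (map val j) == p)
  (fun j => RtoC (INR (B_coef (e :: k) (map val j))) *
     ccoef b a (addc (e :: k) (map val j)) n)%C) /=.
set s := (RtoC (INR n) - a)%C.
rewrite (big_ord_widen M.+1 (fun j : nat => binv e j s * \csum_(i < n) dcoef b a k (p - j)%N i)%C) ?ltnS //.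
rewrite big_mkcond /= !big_distrr /=; apply: eq_bigr => x _.
case: ifP => [xp|/negbT xp]; last first.
  rewrite Cmult_0_r big1 ?Cmult_0_r // => t /eqP E.
  by move: xp; rewrite -E; lia.
transitivity (RtoC (weight_at b (size k).+1 n) * (RtoC ((-1) ^ x * INR 'C(e + x - 1, x)) / s ^ (e + x) *
  \csum_(i < n) (RtoC ((-1) ^ (p - x)%N) *
    \big[Cplus/RtoC 0]_(j : (size k).-tuple 'I_M.+1 | sumn (map val j) == (p - x)%N)
      (RtoC (INR (B_coef k (map val j))) * ccoef b a (addc k (map val j)) i))))%C.
  by congr (_ * (_ * _))%C; apply: eq_bigr => i _; apply: IH; lia.
rewrite -big_distrr exchange_big /=.
rewrite !big_distrr /=; apply: eq_big => [t|t _]; first by apply/idP/idP => /eqP E; apply/eqP; lia.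
rewrite B_coef_cons addc_cons ccoef_cons -/s.
rewrite size_addc ?size_map ?size_tuple //.
have -> : (-1) ^ p = (-1) ^ x * (-1) ^ (p - x) by rewrite -pow_add; congr (_ ^ _); lia.
rewrite -big_distrr /= mult_INR !RtoC_mult /Cdiv; ring.
Qed.

Lemma big_ord_sum_n_m (G : AbelianMonoid) (op : Monoid.law (zero : G)) (f g : nat -> G) N :
  (forall x y, op x y = plus x y) -> g 0%N = zero ->
  (forall n, (0 < n < N)%N -> f n = g n) -> sum_n_m f 1 N.-1 = \big[op/zero]_(n < N) g n.
Proof.
move=> opE g0; case: N => [|N] fg; first by rewrite big_ord0 sum_n_m_zero.
elim: N fg => [|N IH] fg /=.
  by rewrite sum_n_m_zero // big_ord_recl big_ord0 g0 opE plus_zero_r.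
rewrite sum_n_Sm; last by apply/leP.
rewrite big_ord_recr opE -IH => [|n nN]; last by apply: fg; lia.
by congr plus; apply: fg; lia.
Qed.

Lemma rsum_sum_n_m (f g : nat -> R) N : g 0%N = 0 ->
  (forall n, (0 < n < N)%N -> f n = g n) -> sum_n_m f 1 N.-1 = \rsum_(n < N) g n.
Proof. exact: (@big_ord_sum_n_m R_AbelianMonoid Rplus). Qed.

Lemma csum_sum_n_m (f g : nat -> C) N : g 0%N = RtoC 0 ->
  (forall n, (0 < n < N)%N -> f n = g n) -> sum_n_m f 1 N.-1 = \csum_(n < N) g n.
Proof. exact: (@big_ord_sum_n_m C_AbelianMonoid Cplus). Qed.

Lemma csum_nil b a N : (0 < N)%N -> \csum_(n < N) ccoef b a [::] n = RtoC 1.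
Proof. by case: N => // N _; rewrite big_ord_recl big1 //= Cplus_0_r. Qed.

Lemma rsum_nil b N : (0 < N)%N -> \rsum_(n < N) coef b [::] n = 1.
Proof. by case: N => // N _; rewrite big_ord_recl big1 //= Rplus_0_r. Qed.

Lemma dec_sum_zeta a k f N : (0 < N)%N ->
  (forall i n, f i.+1 n = / (RtoC (INR n) - a) ^ nth 0%N k i)%C ->
  dec_sum (K := C_Ring) (size k) f N = \csum_(n < N) ccoef false a k n.
Proof.
elim: k f N => [|e k IH] f N N0 fE; first by rewrite csum_nil.
apply: csum_sum_n_m; first exact: ccoef_at0.
move=> n /andP[n0 _].
transitivity (mult (f 1%N n) (dec_sum (K := C_Ring) (size k) (fun i => f i.+1) n)) => //.
rewrite (IH (fun i => f i.+1)) //.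
by rewrite ccoef_cons fE /mult /= /weight_at /Cdiv Cmult_1_l.
Qed.

(* The substitution n_i = 2 m_i - r - 1 + i turns the summation over m into one
   over n with alternating parities. *)
Lemma dec_sum_T a k f N : (0 < N)%N ->
  (forall i m, (i < size k)%N -> f i.+1 m =
     RtoC 2 / (RtoC (2 * INR m - INR (size k) + INR i) - a) ^ nth 0%N k i)%C ->
  dec_sum (K := C_Ring) (size k) f N = \csum_(n < (2 * N - size k).-1) ccoef true a k n.
Proof.
elim: k f N => [|e k IH] f N N0 fE; first by rewrite csum_nil //= subn0; lia.
rewrite -[LHS]/(sum_n_m (fun m => mult (f 1%N m) (dec_sum (size k) (fun i => f i.+1) m)) 1 N.-1).
have inner m : (0 < m)%N ->
    dec_sum (K := C_Ring) (size k) (fun i => f i.+1) m = \csum_(n < (2 * m - size k).-1) ccoef true a k n.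
  move=> m0; apply: IH => // i l ik; rewrite fE //=; congr (_ / (RtoC _ - _) ^ _)%C.
  by rewrite -/(INR (size k).+1) -/(INR i.+1) !S_INR; ring.
elim: N N0 => // N IHN _.
case: N IHN => [|N] IHN.
  rewrite sum_n_m_zero //= muln1 big1 // => -[n nn] _ /=.
  have -> : n = 0%N by move: nn => /=; lia.
  exact: ccoef_at0.
rewrite sum_n_Sm; last by apply/leP.
rewrite IHN // inner //= fE // /plus /mult /=.
(* In the first case the new m leaves no room for smaller indices: its inner sum is empty and both
   sides vanish. *)
have [lt|ge] := ltnP (2 * N.+1) (size k).+1.
  have -> : (2 * N.+1 - size k).-1 = 0%N by lia.
  rewrite big_ord0 Cmult_0_r Cplus_0_r.
  have -> : (2 * N.+1 - (size k).+1).-1 = 0%N by lia.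
  rewrite big_ord0 big1 // => -[n nn] _ /=.
  have -> : n = 0%N by lia.
  exact: ccoef_at0.
have [q Eq] : exists q, (2 * N.+1 = (size k).+1 + q)%N by exists (2 * N.+1 - (size k).+1)%N; lia.
have -> : (2 * N.+2 - (size k).+1).-1 = q.+1 by lia.
have -> : (2 * N.+1 - (size k).+1).-1 = q.-1 by lia.
have -> : (2 * N.+1 - size k).-1 = q by lia.
(* One more m admits two more n: the first has the wrong parity and weight 0, the second is n = 2 m
   - r. *)
rewrite [in RHS]big_ord_recr /=; congr Cplus.
  case: q Eq => [|q] Eq //=; rewrite big_ord_recr /= ccoef_cons /weight_at.
  have -> : odd ((size k).+1 + q).
    have -> : ((size k).+1 + q = N.*2.+1)%N by lia.
    by rewrite /= odd_double.
  by rewrite /Cdiv !Cmult_0_l Cplus_0_r.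
rewrite ccoef_cons /weight_at -Eq mul2n odd_double; congr (_ / (RtoC _ - _) ^ _ * _)%C.
have := f_equal INR Eq; rewrite mult_INR plus_INR; set x := INR N.+1; set y := INR (size k).+1.
by rewrite -/(INR (size k).+1) -/y -/(INR N.+1) -/x /=; lra.
Qed.

(** * The polylogarithms of the statement as power series *)

Section Polylogarithms.

Variables (b : bool) (kappa : R) (u : nat -> nat -> R).
Hypotheses (kappa_gt0 : 0 < kappa) (uE : forall r n, kappa * u r n = weight_at b r n).

(** A has 2^r in front of a sum of indicators, while [weight_at] puts a 2 on each index; [kappa]
    moves one form into the other. *)
Lemma dec_sum_coef k f N : (0 < N)%N ->
  (forall i n, (i < size k)%N -> f i.+1 n = u (size k - i) n / INR n ^ nth 0%N k i) ->
  kappa ^ size k * dec_sum (K := R_Ring) (size k) f N = \rsum_(n < N) coef b k n.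
Proof.
elim: k f N => [|e k IH] f N N0 fE; first by rewrite rsum_nil //= /one /=; ring.
transitivity (sum_n_m (fun n => kappa ^ (size k).+1 *
    (f 1%N n * dec_sum (K := R_Ring) (size k) (fun i => f i.+1) n)) 1 N.-1).
  by symmetry; apply: (sum_n_m_mult_l (K := R_Ring)).
apply: rsum_sum_n_m; first exact: coef_at0.
move=> n /andP[n0 _].
rewrite coef_cons -(IH (fun i => f i.+1)) // => [|i l ik]; last by rewrite fE.
by rewrite fE //= subn0 -uE /Rdiv; ring.
Qed.

Lemma RSum_L (k : seq nat) f x : 0%N \notin k -> k != [::] -> 0 < x < 1 ->
  (forall i n, (i < size k)%N ->
     f i.+1 n = u (size k - i) n * ((if i == 0%N then x ^ n else 1) / INR n ^ nth 0%N k i)) ->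
  kappa ^ size k * RSum (size k) f = L b k x.
Proof.
case: k => [//|e k] k0 _ x01 fE; have x1 : Rabs x < 1 by rewrite Rabs_pos_eq; lra.
have kp := pow_lt _ (size (e :: k)) kappa_gt0.
have E N : (0 < N)%N -> kappa ^ size (e :: k) * dec_sum (K := R_Ring) (size (e :: k)) f N =
    \rsum_(n < N) (coef b (e :: k) n * x ^ n).
  move=> N0; transitivity (sum_n_m (fun n => kappa ^ (size k).+1 *
      (f 1%N n * dec_sum (K := R_Ring) (size k) (fun i => f i.+1) n)) 1 N.-1).
    by symmetry; apply: (sum_n_m_mult_l (K := R_Ring)).
  apply: (@rsum_sum_n_m _ (fun n => coef b (e :: k) n * x ^ n)); first by rewrite coef_at0; ring.
  move=> n /andP[n0 _].
  rewrite coef_cons -(@dec_sum_coef k (fun i => f i.+1)) // => [|i l ik]; last first.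
    by rewrite fE //= subSS /Rdiv; ring.
  by rewrite fE // -uE /= subn0 /Rdiv; ring.
have lim : is_lim_seq (fun N => \rsum_(n < N) (coef b (e :: k) n * x ^ n)) (L b (e :: k) x).
  apply/is_lim_seq_incr_1.
  have /PSeries_correct H := ex_pseries_coef b k0 x1.
  apply: is_lim_seq_ext (H : is_lim_seq _ (L b (e :: k) x)) => N.
  rewrite sum_nE; apply: eq_bigr => n _.
  by rewrite pow_n_pow /scal /= /mult /=; ring.
have limD : is_lim_seq (dec_sum (K := R_Ring) (size (e :: k)) f)
    (/ kappa ^ size (e :: k) * L b (e :: k) x).
  apply: is_lim_seq_ext_loc (is_lim_seq_scal_l _ _ (L b (e :: k) x) lim).
  exists 1%N => N /leP N0; rewrite -E // -Rmult_assoc Rinv_l; first by ring.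
  by apply: Rgt_not_eq.
rewrite /RSum (is_lim_seq_unique _ _ limD) /= -Rmult_assoc Rinv_r ?Rmult_1_l //.
exact: Rgt_not_eq kp.
Qed.

End Polylogarithms.

Lemma Li_L k x : is_composition k -> 0 < x < 1 -> Li k x = L false k x.
Proof.
move=> /andP[k0 kp] x01.
rewrite -(@RSum_L false 1 (fun _ _ => 1) Rlt_0_1 _ k (fun i n =>
   (if (i == 1)%N then x ^ n else 1) / INR n ^ entry k i) x) //.
- by rewrite pow1 Rmult_1_l.
- by move=> r n; rewrite Rmult_1_l.
- by move=> i n ik; rewrite Rmult_1_l.
Qed.

Lemma A_fun_L k x : is_composition k -> 0 < x < 1 -> A_fun k x = L true k x.
Proof.
move=> /andP[k0 kp] x01.
rewrite -(@RSum_L true 2 (fun r n => if odd (r + n) then 0 else 1) _ _ k (fun i n =>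
   if (n == dep k + 1 - i %[mod 2])%N
    then (if (i == 1)%N then x ^ n else 1) / INR n ^ entry k i else 0) x) //.
- lra.
- by move=> r n; rewrite /weight_at; case: odd; ring.
- move=> i n ik; rewrite /dep addn1 subSS !modn2 oddD.
  case: (odd n); case: (odd (size k - i)) => /=; rewrite ?Rmult_1_l ?Rmult_0_l //.
Qed.

Lemma not_positive_integer_nbhd a : ~ positive_integer a ->
  exists rho c, [/\ 0 < rho <= 1, 0 < c & forall n h, Cmod h < rho ->
    c * INR n.+1 <= Cmod (RtoC (INR n.+1) - (a + h))%C].
Proof.
move=> /not_positive_integer_dist[c [c0 Hc]].
(* Half of c absorbs the shift by h because n >= 1; the cap 1 is needed for products of jets. *)
exists (Rmin 1 (c / 2)), (c / 2); split; first 1 last.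
- lra.
- move=> n h hr; have := Rlt_le_trans _ _ _ hr (Rmin_r _ _) => h2.
  have n1 : 1 <= INR n.+1 by rewrite S_INR; have := pos_INR n; lra.
  have := Cmod_triangle (RtoC (INR n.+1) - (a + h))%C h.
  have -> : (RtoC (INR n.+1) - (a + h) + h)%C = (RtoC (INR n.+1) - a)%C by ring.
  have := Hc n; nra.
by split; [apply: Rmin_glb_lt; lra|exact: Rmin_l].
Qed.

(** * Integral, series and continuation together *)

Section MainStep.

Variables (b : bool) (Z : seq nat -> C -> C) (f : C -> R -> C) (k : seq nat) (m : nat).
Hypotheses (k_comp : is_composition k)
  (ZE : forall e k' a l, 0%N \notin k' ->
     Ccvg (fun N => \csum_(n < N) ccoef b a (e.+2 :: k') n) l ->
     Z (e.+2 :: k') (RtoC 1 - a)%C = l)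
  (fE : forall a x, 0 < x < 1 ->
     f a x = (RtoC (INR m`!) * step_integrand b a m k [::] 1 x)%C).

Let kd := plus_head (hoffman_dual (rev k)).
(** One formula for all [a]: the integral itself for Re a < 1 and its continuation elsewhere. *)
Let F a := weighted_sum Z kd (size kd) m (RtoC 1 - a)%C.

Lemma kd_cons : exists e k', kd = e.+2 :: k' /\ 0%N \notin k'.
Proof.
have [/andP[] ] : is_hoffman_dual (rev k) (hoffman_dual (rev k)).
  apply: hoffman_dualP; case/andP: k_comp => k0 kp.
  by rewrite /is_composition mem_rev kp -size_eq0 size_rev size_eq0 k0.
rewrite /kd; case: (hoffman_dual _) => [//|e k'] _; rewrite inE negb_or => /andP[e0 kp] _ _.
by case: e e0 => // e _; exists e, k'.
Qed.

Lemma addc_kd (t : (size kd).-tuple 'I_m.+1) : exists e k',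
  addc kd (map val t) = e.+2 :: k' /\ 0%N \notin k'.
Proof.
have [e [k' [E k0]]] := kd_cons; move: t; rewrite E /= => t.
case/tupleP: t => x t; rewrite addc_cons; exists (e + x)%N, (addc k' (map val t)).
split; first by [].
have st : size (map val t) = size k' by rewrite size_map size_tuple.
move: (map val t) st => {t} s st; clear E x.
elim: k' s k0 st => [|g k' IH] [|y s] //.
rewrite addc_cons !inE !negb_or => /andP[g0 k0] [/(IH _ k0) ->].
by rewrite andbT; case: g g0.
Qed.

Lemma Z_cvg a (t : (size kd).-tuple 'I_m.+1) : ~ positive_integer a ->
  Ccvg (fun N => \csum_(n < N) ccoef b a (addc kd (map val t)) n)
    (Z (addc kd (map val t)) (RtoC 1 - a)%C).
Proof.
move=> na; have [e [k' [-> k0]]] := addc_kd t.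
have [rho [c [r01 c0 Hc]]] := not_positive_integer_nbhd na.
have [[l Hl] _] := @ccoef_series b a rho c r01 c0 Hc e k' k0.
by rewrite (ZE k0 Hl).
Qed.

Lemma ex_derive_F a : ~ positive_integer a ->
  ex_derive (K := C_AbsRing) (V := C_NormedModule) F a.
Proof.
move=> na; have [rho [c [r01 c0 Hc]]] := not_positive_integer_nbhd na.
apply: (@quadratic_at_ex_derive a rho r01).
have nh h : Cmod h < rho -> ~ positive_integer (a + h).
  move=> hr [p [p0 E]]; case: p p0 E => // p _ E.
  have := Hc p h hr; rewrite E /Cminus Cplus_opp_r Cmod_0.
  by have := INR_S_gt0 p; nra.
pose u (t : (size kd).-tuple 'I_m.+1) :=
  (RtoC ((-1) ^ m * INR m`!) * RtoC (INR (B_coef kd (map val t))))%C.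
have [l [M [M0 HM]]] : quadratic_at a rho (fun z =>
    \big[Cplus/RtoC 0]_(t : (size kd).-tuple 'I_m.+1 | sumn (map val t) == m)
       (u t * Z (addc kd (map val t)) (RtoC 1 - z)))%C.
  apply: quadratic_at_big => t _.
  have Zt h : Cmod h < rho -> Ccvg (fun N => \csum_(n < N) ccoef b (a + h)%C (addc kd (map val t)) n)
     (Z (addc kd (map val t)) (RtoC 1 - (a + h)))%C.
    by move=> hr; apply: Z_cvg; apply: nh.
  have [e [k' [E k0]]] := addc_kd t; rewrite E in Zt *.
  exact: (proj2 (@ccoef_series b a rho c r01 c0 Hc e k' k0)
            (fun z => Z (e.+2 :: k') (RtoC 1 - z)%C)).
exists l, M; split=> // h hr; apply: Rle_trans (HM h hr); apply: Req_le.
have FE z : F z = \big[Cplus/RtoC 0]_(t : (size kd).-tuple 'I_m.+1 | sumn (map val t) == m)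
       (u t * Z (addc kd (map val t)) (RtoC 1 - z))%C.
  rewrite /F /weighted_sum big_distrr /=; apply: eq_bigr => t _.
  by rewrite /u !Cmult_assoc.
by rewrite !FE.
Qed.

Lemma F_cvg a : ~ positive_integer a ->
  Ccvg (fun N => \csum_(n < N) dcoef b a kd m n) (RtoC (/ INR m`!) * F a)%C.
Proof.
move=> na; have f0 := INR_fact_gt0 m.
have -> : (RtoC (/ INR m`!) * F a)%C = (RtoC ((-1) ^ m) *
   \big[Cplus/RtoC 0]_(t : (size kd).-tuple 'I_m.+1 | sumn (map val t) == m)
     (RtoC (INR (B_coef kd (map val t))) * Z (addc kd (map val t)) (RtoC 1 - a)))%C.
  rewrite /F /weighted_sum Cmult_assoc -RtoC_mult; congr (RtoC _ * _)%C.
  by field; lra.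
have H := Ccvg_mull (RtoC ((-1) ^ m)) (@Ccvg_big _ (index_enum _)
  (fun t : (size kd).-tuple 'I_m.+1 => sumn (map val t) == m) _ _
  (fun t _ => Ccvg_mull (RtoC (INR (B_coef kd (map val t)))) (Z_cvg t na))).
apply: Ccvg_ext H => N.
symmetry; transitivity (\csum_(n < N) (RtoC ((-1) ^ m) *
  \big[Cplus/RtoC 0]_(t : (size kd).-tuple 'I_m.+1 | sumn (map val t) == m)
     (RtoC (INR (B_coef kd (map val t))) * ccoef b a (addc kd (map val t)) n)))%C.
  by apply: eq_bigr => n _; apply: dcoef_weighted.
rewrite -big_distrr exchange_big /=; congr Cmult; apply: eq_bigr => t _.
by rewrite big_distrr.
Qed.

Lemma is_RInt_gen_F a : Re a < 1 ->
  is_RInt_gen (V := C_R_NormedModule) (f a) (at_right 0) (at_left 1) (F a).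
Proof.
move=> ra; have f0 := INR_fact_gt0 m.
have na : ~ positive_integer a.
  move=> [p [p0 E]]; move: ra; rewrite E /=; case: p p0 {E} => // p _.
  by rewrite -/(INR p.+1) S_INR; have := pos_INR p; lra.
have [c [c0 Hc]] := not_positive_integer_dist na.
case Ek: k k_comp => [//|e k']; rewrite -Ek => /andP[_ kp].
have [e0 k0] : (0 < e)%N /\ 0%N \notin k'.
  by move: kp; rewrite Ek inE negb_or eq_sym -lt0n => /andP.
(* The [e] letters dx / x read from the empty index give the same ones as [e.-1] letters read after
   the initial [:: 1]. *)
have EK : dual_word (plus_head (ncons e 1%N [::])) k' = kd.
  rewrite /kd -dual_word_hoffman // Ek /dual_word /=; congr foldl.
  case: e e0 {Ek} => // e _ /=.
  by have -> : ncons e 1%N [:: 1%N] = 1%N :: ncons e 1%N [::] by elim: e => //= e ->.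
have e1 : (0 < e)%N || ([::] != [::] :> seq nat) by rewrite e0.
have red := @reduces_word b a m c c0 Hc ra e k' [::] k0 isT e1.
rewrite EK -Ek in red.
have int : is_RInt_gen (V := C_R_NormedModule) (step_integrand b a m k [::] 1)
    (at_right 0) (at_left 1) (RtoC (/ INR m`!) * F a)%C.
  (* The initial cofactor u^(-a) log^m u / m! is not affected by truncation. *)
  have one N x : (0 < N)%N -> step_integrand b a m k [::] 1 x = step_integrand b a m k [::] N x.
    by case: N => // N _; rewrite /step_integrand !dsum_nil.
  have diff x : 0 < x < 1 -> exists l, Cderive (step_integrand b a m k [::] 1) x l.
    move=> x01; have x0 : x <> 0 by lra.
    have [dq dL] : exists dq, is_derive (fun x => L b k x / x) x dq.
      rewrite Ek; case: e e0 {red EK Ek e1} => // e _; eexists.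
      exact: is_derive_Rmult (is_derive_L b e k0 x01) (is_derive_inv _ _ _ (is_derive_id x) x0).
    eexists; apply: Cderive_mult (Cderive_RtoC dL) _.
    apply: (@Cderive_comp (dsum b a m 1 [::]) (fun x => - ell b x)).
      apply: Cderive_sum => n; apply: Cderive_sum => p; apply: Cderive_mult.
        exact: Cderive_const.
      exact: Cderive_expmon.
    by apply: is_derive_opp; apply: is_derive_ell; lra.
  apply: reduces_is_RInt_gen red (F_cvg na) _ _ _.
  - by move=> N x N0 _; apply: one.
  - by move=> x /diff[l [dr _]]; apply: ex_derive_continuous; exists (Re l).
  - by move=> x /diff[l [_ di]]; apply: ex_derive_continuous; exists (Im l).
have -> : F a = scal (INR m`! : R_AbsRing) ((RtoC (/ INR m`!) * F a)%C : C_R_NormedModule).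
  case: (F a) => x y; rewrite /scal /= /prod_scal /= /scal /= /mult /=.
  by congr pair; field; lra.
apply: is_RInt_gen_ext (is_RInt_gen_scal _ _ _ int).
apply: (Filter_prod _ _ _ (fun b0 => 0 < b0 < 1) (fun b1 => 0 < b1 < 1)).
- exists (mkposreal _ Rlt_0_1) => x; rewrite /ball /= /AbsRing_ball /= /abs /minus /plus /opp /=.
  by move=> /Rabs_def2; lra.
- exists (mkposreal _ Rlt_0_1) => x; rewrite /ball /= /AbsRing_ball /= /abs /minus /plus /opp /=.
  by move=> /Rabs_def2; lra.
move=> b0 b1 b01 b11 x /= xb; rewrite fE; last first.
  by move: xb; rewrite /Rmin /Rmax; case: Rle_dec; lra.
case: (step_integrand _ _ _ _ _ _ _) => p q.
by rewrite /scal /= /prod_scal /= /scal /= /mult /= /Cmult /=; congr pair; ring.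
Qed.

Lemma integral01_F alpha : ~ positive_integer alpha -> integral01 f alpha (F alpha).
Proof.
by move=> na; exists F; split=> //; [exact: is_RInt_gen_F|exact: ex_derive_F].
Qed.

End MainStep.

Lemma Ccvg_reindex S T (l : C) (h : nat -> nat) d :
  (forall N, (N - d <= h N)%N) -> (forall N, (0 < N)%N -> T N = S (h N)) -> Ccvg S l -> Ccvg T l.
Proof.
move=> hN TS Sl eps /Sl[N0 H]; exists (N0 + d + 1)%N => N NN.
by rewrite TS; [apply: H; have := hN N|]; lia.
Qed.

Lemma zetaH_ccoef k a l : Ccvg (fun N => \csum_(n < N) ccoef false a k n) l ->
  zetaH k (RtoC 1 - a)%C = l.
Proof.
move=> H; apply: Ccvg_CSum; apply: (@Ccvg_reindex _ _ _ id 0 _ _ H) => N; first by rewrite subn0.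
move=> N0; apply: dec_sum_zeta => // i n; congr (/ _ ^ _)%C; ring.
Qed.

Lemma TH_ccoef k a l : Ccvg (fun N => \csum_(n < N) ccoef true a k n) l ->
  TH k (RtoC 1 - a)%C = l.
Proof.
move=> H; apply: Ccvg_CSum.
apply: (@Ccvg_reindex _ _ _ (fun N => (2 * N - size k).-1) (size k).+1 _ _ H) => N; first lia.
move=> N0; apply: dec_sum_T => // i n _; congr (_ / _ ^ _)%C.
rewrite S_INR (RtoC_plus (INR i)) (RtoC_plus (_ - _)) RtoC_minus RtoC_mult /dep.
ring.
Qed.

Lemma integrand_step b k m a x : 0 < x < 1 ->
  (RtoC (L b k x * ln (swap b x) ^ m) / (RtoC x * cpower (swap b x) a))%C =
  (RtoC (INR m`!) * step_integrand b a m k [::] 1 x)%C.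
Proof.
move=> x01; have f0 := INR_fact_gt0 m.
rewrite /step_integrand dsum_nil /expmon /cpower /ell Ropp_involutive.
set y := ln _.
have E : (cexp (a * RtoC y) * cexp (- a * RtoC y))%C = RtoC 1.
  by rewrite -cexp_plus -Cmult_plus_distr_r Cplus_opp_r Cmult_0_l cexp_RtoC exp_0.
have c0 : cexp (a * RtoC y) <> RtoC 0.
  by move=> c0; move: E; rewrite c0 Cmult_0_l => /RtoC_inj; lra.
have -> : cexp (- a * RtoC y) = (/ cexp (a * RtoC y))%C.
  by rewrite -[RHS]Cmult_1_r -E; field.
have x0 : RtoC x <> RtoC 0 by move/RtoC_inj; lra.
have m0 : RtoC (INR m`!) <> RtoC 0 by move/RtoC_inj; lra.
rewrite RtoC_mult RtoC_div; last lra.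
rewrite RtoC_div; last lra.
by field.
Qed.

Local Open Scope nat_scope.
Unset Implicit Arguments.

Theorem theorem2p1 (k : seq nat) (m : nat) (alpha : C) :
  is_composition k -> 0 < m -> ~ positive_integer alpha ->
  let n := weight k + 1 - dep k in
  let kd := plus_head (hoffman_dual (rev k)) in
  integral01 (Li_integrand k m) alpha
    (weighted_sum zetaH kd n m (RtoC 1 - alpha)%C)
  /\
  integral01 (A_integrand k m) alpha
    (weighted_sum TH kd n m (RtoC 1 - alpha)%C).
Proof.
move=> ck _ na n kd.
have -> : n = size kd.
  rewrite /n /kd -dual_word_hoffman //; case/andP: ck => _ kp.
  by have := size_dual_word [:: 1%N] kp; rewrite /weight /dep /=; lia.
split.
  apply: (@integral01_F false zetaH _ k m ck) => // [e k' a l _|a x x01].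
    exact: zetaH_ccoef.
  by rewrite -integrand_step // /Li_integrand Li_L.
apply: (@integral01_F true TH _ k m ck) => // [e k' a l _|a x x01].
  exact: TH_ccoef.
by rewrite -integrand_step // /A_integrand A_fun_L.
Qed.
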